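(* Let $A=T(V)/(R)$ be an $N$-homogeneous algebra. Endowed with the Koszul cup product $\underset{K}{\smile}$, $HK^{\bullet}(A)$ and $HK^{\bullet}(A,k)$ are graded associative algebras. For any $A$-bimodule $M$, $HK^{\bullet}(A,M)$ is a graded $HK^{\bullet}(A)$-bimodule for the actions defined by $\underset{K}{\smile}$.
   Context: $k$ is a field, $N\ge 2$ an integer, $V$ a $k$-vector space, $R\subseteq V^{\otimes N}$ a subspace, and $A=T(V)/(R)$, graded by weight ($V$ in weight 1). $\otimes$ means $\otimes_k$; $A$-bimodules are left modules over $A^e=A\otimes A^{op}$; $k$ is an $A$-bimodule on which $V$ acts by zero on both sides. For $p\ge 0$, $W_p=\bigcap_{i+N+j=p}V^{\otimes i}\otimes R\otimes V^{\otimes j}\subseteq V^{\otimes p}$ (so $W_p=V^{\otimes p}$ for $p<N$, $W_N=R$). Define $\nu(2p')=Np'$ and $\nu(2p'+1)=Np'+1$. An arbitrary element of $W_p$ is written as a product $x_1\ldots x_p$ with $x_i\in V$ (a linear combination of such tensors is understood); when $q+r+s=p$, viewing it in $V^{\otimes q}\otimes W_r\otimes V^{\otimes s}$, the factor $x_{q+1}\ldots x_{q+r}$ is thought of as an element of $W_r$. All formulas are extended linearly. Koszul $p$-cochains with coefficients in a bimodule $M$ are the elements of $Hom(W_{\nu(p)},M)$ ($k$-linear maps), with differential: if $p=2p'$, $$b_K(f)(x_1\ldots x_{Np'+1})=f(x_1\ldots x_{Np'})x_{Np'+1}-x_1f(x_2\ldots x_{Np'+1});$$ if $p=2p'+1$,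 $$b_K(f)(x_1\ldots x_{Np'+N})=\sum_{0\le i\le N-1}x_1\ldots x_i f(x_{i+1}\ldots x_{i+Np'+1})x_{i+Np'+2}\ldots x_{Np'+N}.$$ The cohomology of $(Hom(W_{\nu(\bullet)},M),b_K)$ is the Koszul cohomology $HK^{\bullet}(A,M)$, and $HK^{\bullet}(A)=HK^{\bullet}(A,A)$. Koszul cup product: for $f:W_{\nu(p)}\to P$, $g:W_{\nu(q)}\to Q$, the cochain $f\underset{K}{\smile} g:W_{\nu(p+q)}\to P\otimes_A Q$ is defined as follows. If $p,q$ are not both odd (so $\nu(p+q)=\nu(p)+\nu(q)$), $$(f\underset{K}{\smile} g)(x_1\ldots x_{\nu(p+q)})=f(x_1\ldots x_{\nu(p)})\otimes_A g(x_{\nu(p)+1}\ldots x_{\nu(p)+\nu(q)}).$$ If $p,q$ are both odd (so $\nu(p+q)=\nu(p)+\nu(q)+N-2$), $$(f\underset{K}{\smile} g)(x_1\ldots x_{\nu(p+q)})=-\sum_{0\le i+j\le N-2}x_1\ldots x_i f(x_{i+1}\ldots x_{i+\nu(p)})x_{i+\nu(p)+1}\ldots x_{\nu(p)+N-j-2}\otimes_A g(x_{\nu(p)+N-j-1}\ldots x_{\nu(p)+\nu(q)+N-j-2})x_{\nu(p)+\nu(q)+N-j-1}\ldots x_{\nu(p)+\nu(q)+N-2},$$ the sum being over integers $i,j\ge 0$. One has $b_K(f\underset{K}{\smile} g)=b_K(f)\underset{K}{\smile} g+(-1)^p f\underset{K}{\smile} b_K(g)$, so $\underset{K}{\smile}$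 is defined on Koszul cohomology classes. The identifications $A\otimes_A M\cong M\cong M\otimes_A A$ and $k\otimes_A k\cong k$ are used. *)

(* Defs.v *)
From HB Require Import structures.
From mathcomp Require Import all_boot all_algebra.
From mathcomp Require Import finmap boolp classical_sets functions.
From mathcomp Require Import monalg.

Set Implicit Arguments.
Unset Strict Implicit.
Unset Printing Implicit Defensive.

Import GRing.Theory.
Local Open Scope ring_scope.
Local Open Scope quotient_scope.

Section LinMap.
Variables (k : fieldType) (U M : lmodType k).

Definition is_linmap : {pred (U -> M)} := fun f => `[< linear f >].

Lemma is_linmap_submod : submod_closed is_linmap.
Proof.
split=> [|c f g /asboolP hf /asboolP hg]; apply/asboolP => a u v.
  by rewrite /= scaler0 addr0.
have E w : (c *: f + g) w = c *: f w + g w by [].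
rewrite !E hf hg !scalerDr !scalerA [c * a]mulrC !addrA; congr (_ + _).
by rewrite addrAC.
Qed.

HB.instance Definition _ :=
  GRing.isSubmodClosed.Build k (U -> M) is_linmap is_linmap_submod.

Record linmap := LinMap { linmap_fun :> U -> M; _ : linmap_fun \in is_linmap }.

HB.instance Definition _ := [isSub for linmap_fun].
HB.instance Definition _ := [Choice of linmap by <:].
HB.instance Definition _ := [SubChoice_isSubLmodule of linmap by <:].

Lemma linmapP (f : linmap) : linear f.
Proof. by case: f => f /= /asboolP. Qed.

HB.instance Definition _ (f : linmap) :=
  GRing.isLinear.Build k U M _ f (linmapP f).

Definition mklin (f : U -> M) (hf : linear f) : linmap :=
  LinMap (introT (asboolP _) hf).

End LinMap.

Section Subspaces.
Variables (k : fieldType) (U : lmodType k).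

Definition lspan (X : set U) : {pred U} := fun x =>
  `[< forall S : submodClosed U, (forall y, X y -> y \in S) -> x \in S >].

Lemma lspanP (X : set U) x :
  reflect (forall S : submodClosed U, (forall y, X y -> y \in S) -> x \in S)
          (x \in lspan X).
Proof. exact: asboolP. Qed.

Lemma lspan_submod (X : set U) : submod_closed (lspan X).
Proof.
split=> [|c u v /lspanP hu /lspanP hv]; apply/lspanP=> S hS; first exact: rpred0.
by rewrite rpredD ?rpredZ ?hu ?hv.
Qed.

HB.instance Definition _ X :=
  GRing.isSubmodClosed.Build k U (lspan X) (lspan_submod X).

Lemma mem_lspan (X : set U) x : X x -> x \in lspan X.
Proof. by move=> Xx; apply/lspanP => S; apply. Qed.

Lemma lspan_ker (M : lmodType k) (f : linmap U M) (X : set U) :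
  (forall x, X x -> f x = 0) -> forall x, x \in lspan X -> f x = 0.
Proof.
move=> fX x /lspanP hx.
pose K : {pred U} := fun x => f x == 0.
have KP : submod_closed K.
  split=> [|c u v /eqP hu /eqP hv]; first by rewrite unfold_in linear0.
  by rewrite unfold_in linmapP hu hv scaler0 addr0.
pose KM := GRing.isSubmodClosed.Build k U K KP.
pose KC : submodClosed U := HB.pack K KM.
by have /(_ _)/eqP := hx KC; apply=> y /fX; rewrite unfold_in => ->.
Qed.

Record subm (S : submodClosed U) := Subm { subm_val : U; _ : subm_val \in S }.

HB.instance Definition _ S := [isSub for @subm_val S].
HB.instance Definition _ S := [Choice of subm S by <:].
HB.instance Definition _ (S : submodClosed U) :=
  [SubChoice_isSubLmodule of subm S by <:].

Lemma subm_val_linear S : linear (@subm_val S).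
Proof. by []. Qed.

HB.instance Definition _ S :=
  GRing.isLinear.Build k (subm S) U _ (@subm_val S) (@subm_val_linear S).

Definition subm_incl (S : submodClosed U) : linmap (subm S) U :=
  mklin (@subm_val_linear S).

End Subspaces.

Section Quotient.
Variables (k : fieldType) (U : lmodType k) (S : submodClosed U).

Lemma submod_oppr : oppr_closed S.
Proof. by move=> u uS; rewrite -scaleN1r rpredZ. Qed.

Definition submod_zmod : zmodClosed U :=
  HB.pack_for (zmodClosed U) (GRing.SubmodClosed.sort S)
    (GRing.SubmodClosed.class S) (GRing.isOppClosed.Build U S submod_oppr).

Definition lquot := Quotient.quot submod_zmod.

HB.instance Definition _ := GRing.Zmodule.on lquot.

Definition lproj (u : U) : lquot := \pi_lquot u.
Definition lrepr (x : lquot) : U := repr x.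

Lemma lreprK x : lproj (lrepr x) = x.
Proof. exact: reprK. Qed.

Lemma lprojE u v : (lproj u == lproj v) = (u - v \in S).
Proof. by rewrite -[RHS]/(u - v \in submod_zmod) Quotient.idealrBE. Qed.

Lemma lprojD u v : lproj (u + v) = lproj u + lproj v.
Proof. by rewrite /lproj; exact: (raddfD (\pi_lquot)). Qed.

Lemma lproj0 : lproj 0 = 0.
Proof. by rewrite /lproj; exact: (raddf0 (\pi_lquot)). Qed.

Lemma lproj_eq0 u : (lproj u == 0) = (u \in S).
Proof. by rewrite -lproj0 lprojE subr0. Qed.

Definition lquot_scale (c : k) (x : lquot) : lquot := lproj (c *: lrepr x).

Lemma lquot_scaleE c u : lquot_scale c (lproj u) = lproj (c *: u).
Proof.
by apply/eqP; rewrite lprojE -scalerBr rpredZ // -lprojE lreprK.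
Qed.

Lemma lquot_scaleA a b x :
  lquot_scale a (lquot_scale b x) = lquot_scale (a * b) x.
Proof. by rewrite -[x]lreprK !lquot_scaleE scalerA. Qed.

Lemma lquot_scale1 : left_id 1 lquot_scale.
Proof. by move=> x; rewrite -[x]lreprK lquot_scaleE scale1r. Qed.

Lemma lquot_scaleDr : right_distributive lquot_scale +%R.
Proof.
move=> c x y; rewrite -[x]lreprK -[y]lreprK -lprojD !lquot_scaleE.
by rewrite -lprojD scalerDr.
Qed.

Lemma lquot_scaleDl x : {morph lquot_scale^~ x : a b / a + b}.
Proof.
by move=> a b /=; rewrite -[x]lreprK !lquot_scaleE -lprojD scalerDl.
Qed.

HB.instance Definition _ := GRing.Zmodule_isLmodule.Build k lquot
  lquot_scaleA lquot_scale1 lquot_scaleDr lquot_scaleDl.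

Lemma lproj_linear : linear lproj.
Proof.
by move=> c u v; rewrite lprojD -lquot_scaleE.
Qed.

HB.instance Definition _ := GRing.isLinear.Build k U lquot _ lproj lproj_linear.

Definition qlift (M : lmodType k) (f : linmap U M) (x : lquot) : M :=
  f (lrepr x).

Section Lift.
Variables (M : lmodType k) (f : linmap U M).
Hypothesis fS : forall x, x \in S -> f x = 0.

Lemma qliftE u : qlift f (lproj u) = f u.
Proof.
apply/eqP; rewrite -subr_eq0 -linearB /= fS //.
by rewrite -lprojE lreprK.
Qed.

Lemma qlift_linear : linear (qlift f).
Proof.
move=> c x y; rewrite -[x]lreprK -[y]lreprK -[_ + _]lproj_linear.
by rewrite !qliftE linmapP.
Qed.

Definition qlin : linmap lquot M := mklin qlift_linear.

End Lift.
End Quotient.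

Section Extension.
Variables (k : fieldType) (U M : lmodType k) (S : submodClosed U).
Variable f : linmap (subm S) M.

Let graph : set (U * M) := fun p => exists s : subm S, p = (val s, f s).
Let good (G : set (U * M)) : Prop :=
  [/\ forall x y y', G (x, y) -> G (x, y') -> y = y',
      forall (c : k) p q, G p -> G q -> G (c *: p + q)
    & graph `<=` G]%classic.

Let good_graph : good graph.
Proof.
split=> // [x y y' [s [-> ->]] [t [/val_inj <- ->]] //|].
by move=> c _ _ [s ->] [t ->]; exists (c *: s + t); rewrite linmapP.
Qed.

Lemma linmap_extension : exists g : linmap U M, forall s, g (val s) = f s.
Proof.
pose P := [set D : set (U * M) | good (D `|` graph)]%classic.
have [|D [gD maxD]] := @Zorn_bigcup _ P.
  move=> F FP Ftot.
  have [->|/set0P[D0 FD0]] := eqVneq F set0.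
    by rewrite bigcup_set0 /P /= set0U; exact: good_graph.
  have two p q : (\bigcup_(D in F) D `|` graph)%classic p ->
      (\bigcup_(D in F) D `|` graph)%classic q ->
      exists2 D, F D & (D `|` graph)%classic p /\ (D `|` graph)%classic q.
    move=> [[D1 FD1 D1p]|gp] [[D2 FD2 D2q]|gq].
    - have [D12|D21] := Ftot _ _ FD1 FD2.
        by exists D2 => //; split; left => //; apply: D12.
      by exists D1 => //; split; left => //; apply: D21.
    - by exists D1 => //; split; [left|right].
    - by exists D2 => //; split; [right|left].
    - by exists D0 => //; split; right.
  split=> [x y y' h h'|c p q hp hq|p hp]; last by right.
    by have [D /FP[gD _ _] [h1 h2]] := two _ _ h h'; apply: gD h1 h2.
  have [D FD [Dp Dq]] := two _ _ hp hq; have [_ gD _] := FP D FD.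
  by case: (gD c p q Dp Dq) => ?; [left; exists D|right].
set G := (D `|` graph)%classic in gD.
have [Gfun Glin Ggraph] := gD.
have G0 : G (0, 0).
  by apply: Ggraph; exists 0; rewrite (raddf0 f) (raddf0 (@subm_val _ _ S)).
have Gscale c p : G p -> G (c *: p).
  by move=> Gp; rewrite -[c *: p]addr0; apply: Glin.
have GB p q : G p -> G q -> G (p - q).
  by move=> Gp Gq; rewrite addrC -scaleN1r; apply: Glin.
have tot x : exists y, G (x, y).
  apply: contrapT => nGx.
  pose G' : set (U * M) := [set p | exists c : k, G (p.1 - c *: x, p.2)]%classic.
  have GG' : (G `<=` G')%classic.
    by move=> [u m] Gu; exists 0; rewrite /= scale0r subr0.
  apply: (maxD G').
    split=> [p Dp|/(_ (x, 0))]; first by apply: GG'; left.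
    move=> /(_ _) G'D; apply: nGx; exists 0; left; apply: G'D.
    by exists 1; rewrite /= scale1r subrr.
  rewrite /P /=; have -> : (G' `|` graph)%classic = G'.
    by apply/setUidPl => p /Ggraph /GG'.
  split=> [u m m' [c Gc] [c' Gc']|a [u m] [u' m'] [c Gc] [c' Gc']|p /Ggraph /GG'//].
    have [cc|cc] := eqVneq c c'; first by apply: Gfun Gc _; rewrite cc.
    case: nGx; exists ((c' - c)^-1 *: (m - m')).
    have := Gscale (c' - c)^-1 _ (GB _ _ Gc Gc').
    congr (G (_, _)) => /=; rewrite opprB.
    have -> : u - c *: x + (c' *: x - u) = (c' - c) *: x.
      by rewrite [LHS]addrC addrA subrK scalerBl.
    by rewrite scalerA mulVf ?scale1r // subr_eq0 eq_sym.
  exists (a * c + c') => /=.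
  have := Glin a _ _ Gc Gc'; congr (G (_, _)) => /=.
  by rewrite scalerBr scalerA scalerDl opprD addrACA.
have [g gP] := choice tot.
have glin : linear g.
  by move=> c u v; apply: Gfun (gP _) (Glin c _ _ (gP u) (gP v)).
exists (mklin glin) => s /=; apply: Gfun (gP _) _.
by apply: Ggraph; exists s.
Qed.

Definition extend : linmap U M := projT1 (cid linmap_extension).

Lemma extendE s : extend (val s) = f s.
Proof. exact: projT2 (cid linmap_extension) s. Qed.

End Extension.

HB.lock Definition mext (k : fieldType) (K : choiceType) (L : lmodType k)
  (phi : K -> L) (g : {malg k[K]}) : L := \sum_(x <- msupp g) g@_x *: phi x.

Section FreeModule.
Variables (k : fieldType) (K : choiceType) (L : lmodType k) (phi : K -> L).

Local Notation mext := (@mext k K L phi).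

Lemma mextEw (d : {fset K}) g : (msupp g `<=` d)%fset ->
  mext g = \sum_(x <- d) g@_x *: phi x.
Proof.
move=> le; rewrite unlock (big_fset_incl _ le) //= => x _ /mcoeff_outdom ->.
by rewrite scale0r.
Qed.

Lemma mext_linear : linear mext.
Proof.
move=> c g h; pose d := (msupp (c *: g + h) `|` (msupp g `|` msupp h))%fset.
rewrite (@mextEw d) ?fsubsetUl // (@mextEw d g); last first.
  by rewrite fsubsetU // fsubsetUl orbT.
rewrite (@mextEw d h); last by rewrite fsubsetU // fsubsetUr orbT.
rewrite scaler_sumr -big_split /=; apply: eq_bigr => x _.
by rewrite mcoeffD mcoeffZ scalerDl scalerA.
Qed.

Definition mlin : linmap {malg k[K]} L := mklin mext_linear.

Lemma mlinE x : mlin << x >> = phi x.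
Proof.
rewrite /= (@mextEw [fset x]%fset) ?msuppU_le // big_seq_fset1 mcoeffUU.
by rewrite scale1r.
Qed.

End FreeModule.

Section FreeModuleGen.
Variables (k : fieldType) (K : choiceType) (L : lmodType k).

Lemma malg_linE (f : linmap {malg k[K]} L) g :
  f g = \sum_(x <- msupp g) g@_x *: f << x >>.
Proof.
rewrite {1}[g]monalgE linear_sum; apply: eq_bigr => x _ /=.
rewrite -linearZ /=; congr (f _); apply/malgP => y.
by rewrite mcoeffZ !mcoeffU mulr_natr.
Qed.

End FreeModuleGen.

Lemma malg_scaleAr (k : comNzRingType) (K : monomType) (c : k)
  (x y : {malg k[K]}) : c *: (x * y) = x * (c *: y).
Proof.
rewrite -mul_malgC -[c *: y]mul_malgC !mulrA; congr (_ * _).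
rewrite [x]monalgE mulr_sumr mulr_suml; apply: eq_bigr => z _.
by rewrite !malgM_def !fgmulUU mul1m mulm1 mulrC.
Qed.

Section FreeAlgebra.
Variables (k : fieldType) (X : choiceType).

Definition free_alg := {malg k[{fmonom X}]}.

HB.instance Definition _ := GRing.Lalgebra.on free_alg.

Lemma free_alg_scaleAr (c : k) (x y : free_alg) : c *: (x * y) = x * (c *: y).
Proof. exact: (@malg_scaleAr k {fmonom X}). Qed.

HB.instance Definition _ :=
  GRing.Lalgebra_isAlgebra.Build k free_alg free_alg_scaleAr.

End FreeAlgebra.

Section Ideals.
Variables (k : fieldType) (A : algType k).

(* proper two-sided ideals; [algType]s are nonzero *)
Record tsideal := Tsideal {
  ts_submod :> submodClosed A;
  ts_mull : forall a x, x \in ts_submod -> a * x \in ts_submod;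
  ts_mulr : forall a x, x \in ts_submod -> x * a \in ts_submod;
  ts_proper : 1 \notin ts_submod
}.

Definition ideal_gen (X : set A) : {pred A} :=
  lspan [set y | exists a x b, X x /\ y = a * x * b]%classic.

HB.instance Definition _ X := GRing.SubmodClosed.on (ideal_gen X).

Lemma ideal_genl (X : set A) a x : x \in ideal_gen X -> a * x \in ideal_gen X.
Proof.
move=> /lspanP hx; pose K : {pred A} := fun y => a * y \in ideal_gen X.
have KP : submod_closed K.
  split=> [|c u v hu hv]; rewrite unfold_in ?mulr0 ?rpred0 //.
  by rewrite mulrDr -scalerAr rpredD ?rpredZ.
pose KC : submodClosed A := HB.pack K (GRing.isSubmodClosed.Build k A K KP).
apply: (hx KC) => _ [b [y [c [Xy ->]]]]; rewrite unfold_in.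
by apply: mem_lspan; exists (a * b), y, c; rewrite !mulrA.
Qed.

Lemma ideal_genr (X : set A) a x : x \in ideal_gen X -> x * a \in ideal_gen X.
Proof.
move=> /lspanP hx; pose K : {pred A} := fun y => y * a \in ideal_gen X.
have KP : submod_closed K.
  split=> [|c u v hu hv]; rewrite unfold_in ?mul0r ?rpred0 //.
  by rewrite mulrDl -scalerAl rpredD ?rpredZ.
pose KC : submodClosed A := HB.pack K (GRing.isSubmodClosed.Build k A K KP).
apply: (hx KC) => _ [b [y [c [Xy ->]]]]; rewrite unfold_in.
by apply: mem_lspan; exists b, y, (c * a); rewrite !mulrA.
Qed.

Lemma mem_ideal_gen (X : set A) x : X x -> x \in ideal_gen X.
Proof. by move=> Xx; apply: mem_lspan; exists 1, x, 1; rewrite mul1r mulr1. Qed.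

Lemma ideal_gen_ker (e : linmap A k^o) (X : set A) :
  (forall a b, e (a * b) = e a * e b) -> (forall x, X x -> e x = 0) ->
  forall x, x \in ideal_gen X -> e x = 0.
Proof.
move=> eM eX; apply: lspan_ker => _ [a [x [b [Xx ->]]]].
by rewrite !eM (eX x Xx) mulr0 mul0r.
Qed.

End Ideals.

HB.lock Definition aquot_mul (k : fieldType) (A : algType k) (I : tsideal A)
  (x y : lquot I) : lquot I := lproj I (lrepr x * lrepr y).

Section AlgQuotient.
Variables (k : fieldType) (A : algType k) (I : tsideal A).

Definition aquot := lquot I.

HB.instance Definition _ := GRing.Lmodule.on aquot.

Definition aproj : A -> aquot := @lproj k A I.

Local Notation aquot_mul := (@aquot_mul k A I).

Lemma aquot_mulE u v : aquot_mul (aproj u) (aproj v) = aproj (u * v).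
Proof.
rewrite unlock; apply/eqP; rewrite lprojE; set u' := lrepr _; set v' := lrepr _.
have -> : u' * v' - u * v = (u' - u) * v' + u * (v' - v).
  by rewrite mulrBl mulrBr addrA subrK.
apply: rpredD; first by apply: ts_mulr; rewrite -lprojE lreprK.
by apply: ts_mull; rewrite -lprojE lreprK.
Qed.

Lemma aprojK x : aproj (lrepr x) = x. Proof. exact: lreprK. Qed.

Lemma aprojD u v : aproj (u + v) = aproj u + aproj v.
Proof. exact: lprojD. Qed.

Lemma aquot_mulA : associative aquot_mul.
Proof.
by move=> x y z; rewrite -[x]aprojK -[y]aprojK -[z]aprojK !aquot_mulE mulrA.
Qed.

Lemma aquot_mul1 : left_id (aproj 1) aquot_mul.
Proof. by move=> x; rewrite -[x]aprojK aquot_mulE mul1r. Qed.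

Lemma aquot_1mul : right_id (aproj 1) aquot_mul.
Proof. by move=> x; rewrite -[x]aprojK aquot_mulE mulr1. Qed.

Lemma aquot_mulDl : left_distributive aquot_mul +%R.
Proof.
move=> x y z; rewrite -[x]aprojK -[y]aprojK -[z]aprojK.
by rewrite -aprojD !aquot_mulE -aprojD mulrDl.
Qed.

Lemma aquot_mulDr : right_distributive aquot_mul +%R.
Proof.
move=> x y z; rewrite -[x]aprojK -[y]aprojK -[z]aprojK.
by rewrite -aprojD !aquot_mulE -aprojD mulrDr.
Qed.

Lemma aquot_1neq0 : aproj 1 != 0.
Proof. by rewrite lproj_eq0 ts_proper. Qed.

HB.instance Definition _ := GRing.Zmodule_isNzRing.Build aquot
  aquot_mulA aquot_mul1 aquot_1mul aquot_mulDl aquot_mulDr aquot_1neq0.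

Lemma aprojM u v : aproj (u * v) = aproj u * aproj v.
Proof. by rewrite -aquot_mulE. Qed.

Lemma aproj_linear : linear aproj.
Proof. exact: lproj_linear. Qed.

Lemma aprojZ (c : k) (u : A) : aproj (c *: u) = c *: aproj u.
Proof. exact/esym/lquot_scaleE. Qed.

Lemma aquot_scaleAl (c : k) (x y : aquot) : c *: (x * y) = c *: x * y.
Proof.
by rewrite -[x]aprojK -[y]aprojK -aprojZ -!aprojM -aprojZ scalerAl.
Qed.

HB.instance Definition _ := GRing.Lmodule_isLalgebra.Build k aquot aquot_scaleAl.

Lemma aquot_scaleAr (c : k) (x y : aquot) : c *: (x * y) = x * (c *: y).
Proof.
by rewrite -[x]aprojK -[y]aprojK -aprojZ -!aprojM -aprojZ scalerAr.
Qed.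

HB.instance Definition _ := GRing.Lalgebra_isAlgebra.Build k aquot aquot_scaleAr.

HB.instance Definition _ := GRing.isLinear.Build k A aquot _ aproj aproj_linear.

Lemma aproj_monoid : monoid_morphism aproj.
Proof. by split=> // u v; exact: aprojM. Qed.

HB.instance Definition _ :=
  GRing.isMonoidMorphism.Build A aquot aproj aproj_monoid.

End AlgQuotient.

Section TensorAlgebra.
Variables (k : fieldType) (V : lmodType k).

Local Notation F := (free_alg k V).

Definition free_gen (v : V) : F := << fmu v >>.

Definition linear_rels : set F :=
  [set y | exists c u v,
     y = free_gen (c *: u + v) - c *: free_gen u - free_gen v]%classic.

Definition free_aug (x : F) : k^o :=
  mcoeff (mone : {fmonom V}) (x : {malg k[{fmonom V}]}).

Lemma free_aug_linear : linear free_aug.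
Proof. by move=> c u v; rewrite /free_aug mcoeffD mcoeffZ. Qed.

Lemma free_augM x y : free_aug (x * y) = free_aug x * free_aug y.
Proof. exact: (rmorphM (mcoeff (mone : {fmonom V}) : {malg k[_]} -> k)). Qed.

Lemma free_aug1 : free_aug 1 = 1.
Proof. exact: (rmorph1 (mcoeff (mone : {fmonom V}) : {malg k[_]} -> k)). Qed.

Lemma free_aug_gen v : free_aug (free_gen v) = 0.
Proof. by rewrite /free_aug mcoeffU fm1_eq1. Qed.

Lemma free_aug_rel x : x \in ideal_gen linear_rels -> free_aug x = 0.
Proof.
apply: (@ideal_gen_ker _ _ (mklin free_aug_linear)) => [a b|_ [c [u [v ->]]]].
  exact: free_augM.
rewrite /= /free_aug !mcoeffB mcoeffZ -!/(free_aug _).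
by rewrite !free_aug_gen mulr0 !subr0.
Qed.

Lemma linear_ideal_proper : 1 \notin ideal_gen linear_rels.
Proof.
by apply/negP => /free_aug_rel /eqP; rewrite free_aug1 oner_eq0.
Qed.

Definition linear_ideal : tsideal F :=
  @Tsideal k F (ideal_gen linear_rels)
    (@ideal_genl _ _ _) (@ideal_genr _ _ _) linear_ideal_proper.

(* T(V): the free algebra on the set V modulo the relations making the
   canonical map V -> T(V) linear *)
Definition tensor_alg := aquot linear_ideal.

HB.instance Definition _ := GRing.Algebra.on tensor_alg.

Definition tgen (v : V) : tensor_alg := aproj linear_ideal (free_gen v).

Lemma tgen_linear : linear tgen.
Proof.
move=> c u v; apply/eqP; rewrite -aprojZ -aprojD lprojE opprD addrA.
by apply: mem_ideal_gen; exists c, u, v.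
Qed.

HB.instance Definition _ :=
  GRing.isLinear.Build k V tensor_alg _ tgen tgen_linear.

Definition word (s : seq V) : tensor_alg := \prod_(v <- s) tgen v.

Lemma word_cat s t : word (s ++ t) = word s * word t.
Proof. exact: big_cat. Qed.

Lemma wordE s : word s = aproj linear_ideal << FMonom s >>.
Proof.
elim: s => [|v s IHs].
  rewrite /word big_nil -(rmorph1 (aproj linear_ideal)); congr (aproj _ _).
  by rewrite -fmoneE.
rewrite /word big_cons -/(word s) IHs -aprojM; congr (aproj _ _).
rewrite [LHS]malgM_def fgmulUU mulr1; congr << _ >>.
by apply/eqP; rewrite fmP fmM fmU.
Qed.

Definition tpow (n : nat) : {pred tensor_alg} :=
  lspan [set y | exists2 s, size s = n & y = word s]%classic.

HB.instance Definition _ n := GRing.SubmodClosed.on (tpow n).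

(* Linear maps out of T(V): functions on words that are linear in each
   letter. *)
Section Lift.
Variable L : lmodType k.

Definition multilinear (phi : seq V -> L) := forall (c : k) s u v t,
  phi (s ++ (c *: u + v) :: t) = c *: phi (s ++ u :: t) + phi (s ++ v :: t).

Variable phi : seq V -> L.
Hypothesis phiP : multilinear phi.

Let phiF : linmap F L := mlin (phi \o @fmonom_val V).

Lemma phiF_rel x : x \in ideal_gen linear_rels -> phiF x = 0.
Proof.
apply: lspan_ker => _ [a [_ [b [[c [u [v ->]]] ->]]]].
pose W s : F := << FMonom s >>.
have wE s w t : phiF (W s * free_gen w * W t) = phi (s ++ w :: t).
  rewrite [_ * _]malgM_def [W s * _]malgM_def !fgmulUU !mulr1 mlinE /=.
  by rewrite !fmM fmU /= -catA.
move: phiF wE => f wE; set r := _ - _ - _.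
have la (y : F) : linear (fun a : F => f (a * r * y)).
  by move=> d p q; rewrite !mulrDl -!scalerAl linmapP.
have lb (y : F) : linear (fun b : F => f (y * r * b)).
  by move=> d p q; rewrite !mulrDr -free_alg_scaleAr linmapP.
have z0 (h : linmap F L) : (forall s, h (W s) = 0) -> forall y, h y = 0.
  by move=> h0 y; rewrite malg_linE big1 // => -[s] _; rewrite h0 scaler0.
apply: (z0 (mklin (la b))) => s; apply: (z0 (mklin (lb _))) => t /=.
have -> : W s * r * W t =
    W s * free_gen (c *: u + v) * W t
    - (c *: (W s * free_gen u * W t)
      + W s * free_gen v * W t).
  by rewrite /r !mulrBr !mulrBl -free_alg_scaleAr -scalerAl opprD addrA.
have fB (p q : F) : f (p - q) = f p - f q by exact: (linearB f).
have fL (p q : F) : f (c *: p + q) = c *: f p + f q by exact: (linmapP f).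
have key (p q r' : L) : p = phi (s ++ (c *: u + v) :: t) -> q = phi (s ++ u :: t) ->
    r' = phi (s ++ v :: t) -> p - (c *: q + r') = 0.
  by move=> -> -> ->; rewrite phiP subrr.
by rewrite fB fL; exact: key (wE _ _ _) (wE _ _ _) (wE _ _ _).
Qed.

Definition tlift : linmap tensor_alg L := qlin (S := linear_ideal) phiF_rel.

Lemma tliftE s : tlift (word s) = phi s.
Proof.
by rewrite wordE [LHS](qliftE phiF_rel) mlinE.
Qed.

End Lift.
End TensorAlgebra.

Arguments tpow {k} V n.

(* A-bimodules on which the two k-actions agree, that is, modules over
   A (x) A^op. *)
Record bimodule (k : fieldType) (A : algType k) := Bimodule {
  bim_sort :> lmodType k;
  lact : A -> bim_sort -> bim_sort;
  ract : bim_sort -> A -> bim_sort;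
  lact_linl : forall m, linear (lact^~ m);
  lact_linr : forall a, linear (lact a);
  lact1 : forall m, lact 1 m = m;
  lactA : forall a b m, lact (a * b) m = lact a (lact b m);
  ract_linl : forall a, linear (ract^~ a);
  ract_linr : forall m, linear (ract m);
  ract1 : forall m, ract m 1 = m;
  ractA : forall m a b, ract m (a * b) = ract (ract m a) b;
  lractA : forall a m b, ract (lact a m) b = lact a (ract m b)
}.

Section Regular.
Variables (k : fieldType) (A : algType k).

Let mul_linl (m : A) : linear (fun a : A => a * m).
Proof. by move=> c x y; rewrite mulrDl scalerAl. Qed.

Let mul_linr (a : A) : linear (fun m : A => a * m).
Proof. by move=> c x y; rewrite mulrDr scalerAr. Qed.

Definition regular_bimodule : bimodule A :=
  @Bimodule k A A (fun a m => a * m) (fun m a => m * a)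
    mul_linl mul_linr (@mul1r A) (fun a b m => esym (mulrA a b m))
    mul_linl mul_linr (@mulr1 A) (@mulrA A) (fun a b m => esym (mulrA a b m)).

Variable e : linmap A k^o.
Hypothesis e1 : e 1 = 1.
Hypothesis eM : forall a b, e (a * b) = e a * e b.

Let aug_linl (c : k^o) : linear (fun a : A => e a * c : k^o).
Proof. by move=> d a b; rewrite linmapP mulrDl -scalerAl. Qed.

Let aug_linr (a : A) : linear (fun c : k^o => e a * c : k^o).
Proof. by move=> d x y; rewrite mulrDr -scalerAr. Qed.

Let aug_1 (c : k^o) : e 1 * c = c.
Proof. by rewrite e1 mul1r. Qed.

Let aug_lA a b (c : k^o) : e (a * b) * c = e a * (e b * c).
Proof. by rewrite eM mulrA. Qed.

Let aug_rA (c : k^o) a b : e (a * b) * c = e b * (e a * c).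
Proof. by rewrite eM mulrA [e a * _]mulrC. Qed.

Let aug_lrA a (c : k^o) b : e b * (e a * c) = e a * (e b * c).
Proof. by rewrite mulrCA. Qed.

(* k, with A acting on both sides through the character e *)
Definition aug_bimodule : bimodule A :=
  @Bimodule k A k^o (fun a c => e a * c) (fun c a => e a * c)
    aug_linl aug_linr aug_1 aug_lA aug_linr aug_linl aug_1 aug_rA aug_lrA.

End Regular.

Section TensorOver.
Variables (k : fieldType) (A : algType k) (P Q : bimodule A).

Definition btens_gen (p : P) (q : Q) : {malg k[(P * Q)%type]} := << (p, q) >>.

Definition btens_rels : set {malg k[(P * Q)%type]} :=
  [set y |
    [\/ exists c p p' q, y = btens_gen (c *: p + p') q
                             - (c *: btens_gen p q + btens_gen p' q),
        exists c p q q', y = btens_gen p (c *: q + q')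
                             - (c *: btens_gen p q + btens_gen p q')
      | exists p a q, y = btens_gen (ract p a) q - btens_gen p (lact a q)]]%classic.

Definition btens : lmodType k := lquot (lspan btens_rels).

Definition pure (p : P) (q : Q) : btens := lproj _ (btens_gen p q).

Lemma pure_linl q : linear (pure^~ q).
Proof.
move=> c p p'; rewrite /pure -lproj_linear; apply/eqP; rewrite lprojE.
by apply: mem_lspan; apply: Or31; exists c, p, p', q.
Qed.

Lemma pure_linr p : linear (pure p).
Proof.
move=> c q q'; rewrite /pure -lproj_linear; apply/eqP; rewrite lprojE.
by apply: mem_lspan; apply: Or32; exists c, p, q, q'.
Qed.

Lemma pure_balanced p a q : pure (ract p a) q = pure p (lact a q).
Proof.
apply/eqP; rewrite lprojE.
by apply: mem_lspan; apply: Or33; exists p, a, q.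
Qed.

Section Lift.
Variables (L : lmodType k) (beta : P -> Q -> L).
Hypothesis beta_linl : forall q, linear (beta^~ q).
Hypothesis beta_linr : forall p, linear (beta p).
Hypothesis beta_bal : forall p a q, beta (ract p a) q = beta p (lact a q).

Let betaF : linmap {malg k[(P * Q)%type]} L := mlin (fun x => beta x.1 x.2).

Lemma betaF_rel x : x \in lspan btens_rels -> betaF x = 0.
Proof.
have E p q : betaF (btens_gen p q) = beta p q by exact: mlinE.
have B u v : betaF (u - v) = betaF u - betaF v by exact: (linearB betaF).
have D c u v : betaF (c *: u + v) = c *: betaF u + betaF v by exact: linmapP.
apply: lspan_ker => _ [[c [p [p' [q ->]]]]|[c [p [q [q' ->]]]]|[p [a [q ->]]]].
- by rewrite B D !E beta_linl subrr.
- by rewrite B D !E beta_linr subrr.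
- by rewrite B !E beta_bal subrr.
Qed.

Definition btens_lift : linmap btens L := qlin betaF_rel.

Lemma btens_liftE p q : btens_lift (pure p q) = beta p q.
Proof. by rewrite [LHS](qliftE betaF_rel) [LHS]mlinE. Qed.

End Lift.
End TensorOver.

Section Identifications.
Variables (k : fieldType) (A : algType k).

(* A (x)_A M -> M, a (x) m |-> a m *)
Definition btens_idl (M : bimodule A) : linmap (btens (regular_bimodule A) M) M :=
  @btens_lift k A (regular_bimodule A) M M (@lact k A M)
    (@lact_linl k A M) (@lact_linr k A M) (@lactA k A M).

(* M (x)_A A -> M, m (x) a |-> m a *)
Definition btens_idr (M : bimodule A) : linmap (btens M (regular_bimodule A)) M :=
  @btens_lift k A M (regular_bimodule A) M (@ract k A M)
    (@ract_linl k A M) (@ract_linr k A M)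
    (fun m a b => esym (ractA m a b)).

Variable e : linmap A k^o.
Hypothesis e1 : e 1 = 1.
Hypothesis eM : forall a b, e (a * b) = e a * e b.

Local Notation kk := (aug_bimodule e1 eM).

Let mulk_linl (d : k^o) : linear (fun c : k^o => c * d : k^o).
Proof. by move=> a x y; rewrite mulrDl -scalerAl. Qed.

Let mulk_linr (c : k^o) : linear (fun d : k^o => c * d : k^o).
Proof. by move=> a x y; rewrite mulrDr -scalerAr. Qed.

Let mulk_bal (c : k^o) a (d : k^o) : e a * c * d = c * (e a * d).
Proof. by rewrite mulrA [c * _]mulrC. Qed.

(* k (x)_A k -> k, c (x) d |-> c d *)
Definition btens_idk : linmap (btens kk kk) kk :=
  @btens_lift k A kk kk kk (fun c d => c * d) mulk_linl mulk_linr mulk_bal.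

End Identifications.

Record relspace (k : fieldType) (V : lmodType k) (N : nat) := Relspace {
  rels :> submodClosed (tensor_alg V);
  rels_tpow : forall x, x \in rels -> x \in tpow V N
}.

Section Augmentation.
Variables (k : fieldType) (V : lmodType k).

Definition taug : linmap (tensor_alg V) k^o :=
  qlin (S := linear_ideal V) (f := mklin (@free_aug_linear k V))
    (@free_aug_rel k V).

Lemma taugE x : taug (aproj (linear_ideal V) x) = free_aug x.
Proof.
exact: (qliftE (f := mklin (@free_aug_linear k V)) (@free_aug_rel k V)).
Qed.

Lemma taug1 : taug 1 = 1.
Proof. by rewrite -(rmorph1 (aproj (linear_ideal V))) taugE free_aug1. Qed.

Lemma taugM x y : taug (x * y) = taug x * taug y.
Proof.
rewrite -[x]aprojK -[y]aprojK -aprojM !taugE; exact: free_augM.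
Qed.

Lemma taug_tgen v : taug (tgen v) = 0.
Proof. by rewrite taugE free_aug_gen. Qed.

Lemma taug_tpow n x : x \in tpow V n.+1 -> taug x = 0.
Proof.
apply: lspan_ker => _ [[//|v s] _ ->].
by rewrite /word big_cons taugM taug_tgen mul0r.
Qed.

End Augmentation.

Arguments taug {k} V.

Section HomogeneousAlgebra.
Variables (k : fieldType) (V : lmodType k) (N : nat).
Hypothesis hN : (2 <= N)%N.
Variable R : relspace V N.

Definition homog_rels : set (tensor_alg V) := [set x | x \in rels R]%classic.

Lemma taug_homog x : x \in ideal_gen homog_rels -> taug V x = 0.
Proof.
apply: ideal_gen_ker => [a b|y /rels_tpow]; first exact: taugM.
by case: N hN => // n _; exact: taug_tpow.
Qed.

Lemma homog_ideal_proper : 1 \notin ideal_gen homog_rels.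
Proof. by apply/negP => /taug_homog /eqP; rewrite taug1 oner_eq0. Qed.

Definition homog_ideal : tsideal (tensor_alg V) :=
  @Tsideal k (tensor_alg V) (ideal_gen homog_rels)
    (@ideal_genl _ _ _) (@ideal_genr _ _ _) homog_ideal_proper.

Definition homog_alg : algType k := aquot homog_ideal.

Definition homog_proj : linmap (tensor_alg V) homog_alg :=
  mklin (@aproj_linear k _ homog_ideal).

Definition homog_aug : linmap homog_alg k^o :=
  qlin (S := homog_ideal) (f := taug V) taug_homog.

Lemma homog_augE x : homog_aug (homog_proj x) = taug V x.
Proof. exact: (qliftE taug_homog). Qed.

Lemma homog_aug1 : homog_aug 1 = 1.
Proof. by rewrite -[LHS]/(homog_aug (homog_proj 1)) homog_augE taug1. Qed.

Lemma homog_augM x y : homog_aug (x * y) = homog_aug x * homog_aug y.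
Proof.
have E u : homog_aug (aproj homog_ideal u) = taug V u by exact: homog_augE.
by rewrite -[x]aprojK -[y]aprojK -aprojM !E taugM.
Qed.

Definition trivial_bimodule : bimodule homog_alg :=
  aug_bimodule homog_aug1 homog_augM.

Definition trivial_idk :
    linmap (btens trivial_bimodule trivial_bimodule) trivial_bimodule :=
  btens_idk homog_aug1 homog_augM.

End HomogeneousAlgebra.

Section SplitWords.
Variables (k : fieldType) (V : lmodType k).

(* x_1 ... x_n |-> B (f (x_1 ... x_i)) (g (x_{i+1} ... x_n)) *)
Definition split_at (L1 L2 L : Type) (i : nat) (B : L1 -> L2 -> L)
    (f : seq V -> L1) (g : seq V -> L2) (s : seq V) : L :=
  B (f (take i s)) (g (drop i s)).

Lemma multilinear_split (L1 L2 L : lmodType k) i (B : L1 -> L2 -> L) f g :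
  (forall y, linear (B^~ y)) -> (forall x, linear (B x)) ->
  multilinear f -> multilinear g -> multilinear (split_at i B f g).
Proof.
move=> Bl Br fM gM c s u v t; rewrite /split_at !take_cat !drop_cat.
case: ifP => _; first by rewrite gM Br.
by case: (i - size s)%N => [|n] /=; rewrite ?cats0 ?take0 ?drop0 ?(gM c [::]) ?(gM c s) ?Br //; rewrite fM Bl.
Qed.

Lemma word_span (x : tensor_alg V) :
  x \in lspan [set y | exists2 s : seq V, True & y = word s]%classic.
Proof.
rewrite -[x]aprojK; set y : free_alg k V := lrepr x.
have -> : y = \sum_(m <- msupp y) y@_m *: (<< m >> : free_alg k V).
  rewrite {1}[y]monalgE; apply: eq_bigr => m _; apply/malgP => m'.
  by rewrite mcoeffZ !mcoeffU mulr_natr.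
rewrite linear_sum; apply: rpred_sum => -[s] _; rewrite linearZ /=.
by apply: rpredZ; apply: mem_lspan; exists s => //; rewrite wordE.
Qed.

Lemma word_span0 (L : lmodType k) (h : linmap (tensor_alg V) L) (X : set (seq V)) :
  (forall s, X s -> h (word s) = 0) ->
  forall x, x \in lspan [set y | exists2 s, X s & y = word s]%classic -> h x = 0.
Proof. by move=> hX; apply: lspan_ker => _ [s Xs ->]; exact: hX. Qed.

Lemma tlift_unique (L : lmodType k) (f : seq V -> L) (fM : multilinear f)
    (h : linmap (tensor_alg V) L) :
  (forall s, h (word s) = f s) -> forall x, tlift fM x = h x.
Proof.
move=> hf x; apply/eqP; rewrite -subr_eq0; apply/eqP.
have dl : linear (fun x => tlift fM x - h x).
  by move=> c u v; rewrite !linmapP scalerBr opprD addrACA.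
apply: (word_span0 (h := mklin dl) (X := setT)) (word_span x) => s _.
by rewrite -[LHS]/(tlift fM (word s) - h (word s)) tliftE hf subrr.
Qed.

Lemma tlift_split (L1 L2 L : lmodType k) i (B : L1 -> L2 -> L) f g
    (fM : multilinear f) (gM : multilinear g)
    (hM : multilinear (split_at i B f g)) :
  (forall y, linear (B^~ y)) -> (forall x, linear (B x)) ->
  forall a b, a \in tpow V i -> tlift hM (a * b) = B (tlift fM a) (tlift gM b).
Proof.
move=> Bl Br a b ai.
have l1 : linear (fun a => tlift hM (a * b) - B (tlift fM a) (tlift gM b)).
  move=> c u v; rewrite mulrDl -scalerAl !linmapP Bl.
  by rewrite scalerBr opprD addrACA.
have l2 (s : seq V) : linear (fun b =>
    tlift hM (word s * b) - B (tlift fM (word s)) (tlift gM b)).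
  move=> c u v; rewrite mulrDr -scalerAr !linmapP Br.
  by rewrite scalerBr opprD addrACA.
apply/eqP; rewrite -subr_eq0; apply/eqP.
apply: (word_span0 (h := mklin l1) (X := [set s | size s = i]%classic)) ai => s si.
apply: (word_span0 (h := mklin (l2 s)) (X := setT)) (word_span b) => t _.
rewrite -[LHS]/(tlift hM (word s * word t)
                - B (tlift fM (word s)) (tlift gM (word t))).
by rewrite -word_cat !tliftE /split_at take_size_cat ?drop_size_cat ?subrr.
Qed.

Lemma multilinear_comp (L L' : lmodType k) (h : linmap L L') (f : seq V -> L) :
  multilinear f -> multilinear (h \o f).
Proof. by move=> fM c s u v t; rewrite /= fM linmapP. Qed.

Lemma multilinear_sum (L : lmodType k) (I : Type) (r : seq I) (P : pred I)
    (F : I -> seq V -> L) :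
  (forall i, multilinear (F i)) ->
  multilinear (fun s => \sum_(i <- r | P i) F i s).
Proof.
move=> FM c s u v t; rewrite scaler_sumr -big_split /=.
by apply: eq_bigr => i _; exact: FM.
Qed.

Lemma multilinear_opp (L : lmodType k) (f : seq V -> L) :
  multilinear f -> multilinear (fun s => - f s).
Proof. by move=> fM c s u v t; rewrite fM opprD scalerN. Qed.

Lemma multilinear_sub (L : lmodType k) (f g : seq V -> L) :
  multilinear f -> multilinear g -> multilinear (fun s => f s - g s).
Proof.
by move=> fM gM c s u v t; rewrite fM gM scalerBr opprD addrACA.
Qed.

Lemma multilinear_word (L : lmodType k) (h : linmap (tensor_alg V) L) :
  multilinear (fun s => h (word s)).
Proof.
move=> c s u v t; rewrite -linmapP; congr (h _).
rewrite !word_cat /word !big_cons linearP mulrDl mulrDr.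
by rewrite -scalerAl -scalerAr.
Qed.

Lemma tlift_linear (L : lmodType k) (f g h : seq V -> L)
    (fM : multilinear f) (gM : multilinear g) (hM : multilinear h) c :
  (forall s, h s = c *: f s + g s) ->
  forall x, tlift hM x = c *: tlift fM x + tlift gM x.
Proof.
move=> hE x; rewrite /= /qlift /= unlock scaler_sumr -big_split /=.
apply: eq_bigr => m _; rewrite hE scalerDr !scalerA; congr (_ *: _ + _).
by rewrite mulrC.
Qed.

End SplitWords.

Definition nu (N p : nat) : nat := (N * p./2 + odd p)%N.

Section Koszul.
Variables (k : fieldType) (V : lmodType k) (N : nat).
Hypothesis hN : (2 <= N)%N.
Variable R : relspace V N.

Local Notation A := (homog_alg hN R).
Local Notation T := (tensor_alg V).

(* W_p, the intersection of the V^{(x) i} (x) R (x) V^{(x) j}, i + N + j = p,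
   inside V^{(x) p} *)
Definition Wsub (p : nat) : {pred T} := fun x =>
  `[< x \in tpow V p /\
      forall i j, (i + N + j)%N = p ->
        x \in lspan [set y | exists a r b,
          [/\ a \in tpow V i, r \in rels R, b \in tpow V j
            & y = a * r * b]]%classic >].

Lemma Wsub_submod p : submod_closed (Wsub p).
Proof.
split=> [|c x y /asboolP[x1 x2] /asboolP[y1 y2]]; apply/asboolP.
  by split=> [|i j _]; exact: rpred0.
split=> [|i j ij]; first by rewrite rpredD ?rpredZ.
by rewrite rpredD ?rpredZ ?x2 ?y2.
Qed.

HB.instance Definition _ p :=
  GRing.isSubmodClosed.Build k T (Wsub p) (Wsub_submod p).

Definition W (p : nat) : lmodType k := subm (Wsub p).

Definition cochain (p : nat) (M : lmodType k) : lmodType k :=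
  linmap (W (nu N p)) M.

(* A linear retraction of T(V) onto W_p.  It is used to evaluate a map f
   defined on W_p at one factor of a tensor, even though the individual words
   x_{q+1} ... x_{q+p} of that tensor need not lie in W_p: on
   V^{(x) q} (x) W_p (x) V^{(x) s} (which contains W_{q+p+s}) the linear
   extension of x_1 ... |-> a (f (x_{q+1} ... x_{q+p})) b does not depend on
   the values of f outside of W_p. *)
Definition Wretract (p : nat) : linmap T (W p) :=
  extend (mklin (f := @id (W p)) (fun _ _ _ => erefl)).

Lemma WretractE p (w : W p) : Wretract p (val w) = w.
Proof. exact: (extendE (mklin (f := @id (W p)) (fun _ _ _ => erefl))). Qed.

Definition wordA (s : seq V) : A := homog_proj hN R (word s).

Definition eval_word p (M : lmodType k) (f : cochain p M) (s : seq V) : M :=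
  f (Wretract (nu N p) (word s)).

Lemma wordA_multilinear : multilinear wordA.
Proof. exact: multilinear_word. Qed.

Lemma eval_word_multilinear p (M : lmodType k) (f : cochain p M) :
  multilinear (eval_word f).
Proof. exact: (multilinear_comp f (multilinear_word (Wretract (nu N p)))). Qed.

Definition onW p (M : lmodType k) (phi : seq V -> M) (phiP : multilinear phi) :
    linmap (W p) M :=
  mklin (f := fun w : W p => tlift phiP (val w))
    (fun c u v => linmapP (tlift phiP) c (val u) (val v)).

Lemma tlift_wordA x : tlift wordA_multilinear x = homog_proj hN R x.
Proof. exact: tlift_unique. Qed.

Lemma tlift_eval_word p (M : lmodType k) (f : cochain p M) (w : W (nu N p)) :
  tlift (eval_word_multilinear f) (val w) = f w.
Proof.
have fl : linear (f \o Wretract (nu N p)).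
  by move=> c u v; rewrite /= !linmapP.
rewrite (tlift_unique _ (h := mklin fl)) //.
by rewrite -[LHS]/(f (Wretract (nu N p) (val w))) WretractE.
Qed.

(* On V^{(x) i} (x) W_{nu p} (x) T(V) the summands x_1 ... x_i f(...) x ... of
   the differential only involve the values of f on W_{nu p}. *)
Lemma sandwichE p (M : bimodule A) (f : cochain p M) i
    (hM : multilinear (split_at i (@lact _ _ M) wordA
            (split_at (nu N p) (@ract _ _ M) (eval_word f) wordA))) a w b :
  a \in tpow V i ->
  tlift hM (a * (val w * b)) =
    lact (homog_proj hN R a) (ract (f w) (homog_proj hN R b)).
Proof.
move=> ai; have wM := wordA_multilinear; have fM := eval_word_multilinear f.
have frM := multilinear_split (nu N p)
  (@ract_linl _ _ M) (@ract_linr _ _ M) fM wM.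
have wp : val w \in tpow V (nu N p) by case: w => w /= /asboolP[].
rewrite (tlift_split wM frM hM (@lact_linl _ _ M) (@lact_linr _ _ M) _ ai).
rewrite (tlift_split fM wM frM (@ract_linl _ _ M) (@ract_linr _ _ M) _ wp).
by rewrite (tlift_unique wM (h := homog_proj hN R)) // 
  (tlift_unique wM (h := homog_proj hN R)) // -(tlift_eval_word f w)
  (_ : fM = eval_word_multilinear f) //; exact: Prop_irrelevance.
Qed.

Section Differential.
Variables (M : bimodule A) (p : nat).

Definition bK_word (f : cochain p M) (s : seq V) : M :=
  if odd p then
    \sum_(i < N) split_at i (@lact _ _ M) wordA
                   (split_at (nu N p) (@ract _ _ M) (eval_word f) wordA) s
  else split_at (nu N p) (@ract _ _ M) (eval_word f) wordA s
       - split_at 1 (@lact _ _ M) wordA (eval_word f) s.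

Lemma bK_word_multilinear f : multilinear (bK_word f).
Proof.
have wM := wordA_multilinear; have fM := eval_word_multilinear f.
have frM := multilinear_split (nu N p)
  (@ract_linl _ _ M) (@ract_linr _ _ M) fM wM.
rewrite /bK_word; case: (odd p).
  apply: multilinear_sum => i.
  exact: multilinear_split (@lact_linl _ _ M) (@lact_linr _ _ M) wM frM.
apply: multilinear_sub => //.
exact: multilinear_split (@lact_linl _ _ M) (@lact_linr _ _ M) wM fM.
Qed.

Definition bK (f : cochain p M) : cochain p.+1 M :=
  onW (nu N p.+1) (bK_word_multilinear f).

Lemma eval_wordP c (f g : cochain p M) s :
  eval_word (c *: f + g) s = c *: eval_word f s + eval_word g s.
Proof. by []. Qed.

Lemma bK_wordP (c : k) f g s :
  bK_word (c *: f + g) s = c *: bK_word f s + bK_word g s.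
Proof.
have E i : split_at i (@ract _ _ M) (eval_word (c *: f + g)) wordA =1
    (fun s => c *: split_at i (@ract _ _ M) (eval_word f) wordA s
              + split_at i (@ract _ _ M) (eval_word g) wordA s).
  by move=> t; rewrite /split_at eval_wordP ract_linl.
rewrite /bK_word; case: (odd p).
  rewrite scaler_sumr -big_split /=; apply: eq_bigr => i _.
  by rewrite {1}/split_at E lact_linr.
rewrite E [in X in _ - X = _]/split_at eval_wordP lact_linr.
by rewrite scalerBr opprD addrACA.
Qed.

Lemma bK_linear : linear bK.
Proof.
move=> c f g; apply/val_inj/funext => w.
exact: (tlift_linear (bK_word_multilinear f) (bK_word_multilinear g)
  (bK_word_multilinear _) (bK_wordP c f g) (val w)).
Qed.

End Differential.

Section Cohomology.
Variables (M : bimodule A) (p : nat).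

Definition cocycles : {pred cochain p M} := fun f => bK f == 0.

Lemma cocycles_submod : submod_closed cocycles.
Proof.
have bL := @bK_linear M p.
have b0 : bK (0 : cochain p M) = 0.
  by have := bL (-1) 0 0; rewrite scaler0 addr0 scaleN1r addNr.
split=> [|c f g /eqP hf /eqP hg]; rewrite unfold_in; first exact/eqP.
by rewrite bL hf hg scaler0 addr0.
Qed.

HB.instance Definition _ :=
  GRing.isSubmodClosed.Build k (cochain p M) cocycles cocycles_submod.

End Cohomology.

Section CohomologyGroup.
Variable M : bimodule A.

(* the cocycles of degree p that are coboundaries *)
Definition coboundaries (p : nat) : {pred subm (@cocycles M p)} :=
  match p return {pred subm (@cocycles M p)} with
  | 0 => fun z => z == 0
  | q.+1 => fun z => `[< exists h : cochain q M, val z = bK h >]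
  end.

Lemma coboundaries_submod p : submod_closed (@coboundaries p).
Proof.
case: p => [|p]; split.
- exact: eqxx.
- by move=> c x y /eqP -> /eqP ->; rewrite scaler0 addr0; exact: eqxx.
- apply/asboolP; exists 0; apply/esym.
  by have := @bK_linear M p (-1) 0 0; rewrite scaler0 addr0 scaleN1r addNr.
move=> c x y /asboolP[g gE] /asboolP[h hE]; apply/asboolP; exists (c *: g + h).
apply: etrans (esym (bK_linear c g h)).
exact: (congr2 (fun u v => c *: u + v) gE hE).
Qed.

HB.instance Definition _ p := GRing.isSubmodClosed.Build k
  (subm (@cocycles M p)) (@coboundaries p) (coboundaries_submod p).

Definition HK (p : nat) : lmodType k := lquot (@coboundaries p).

Definition cocycle (p : nat) : lmodType k := subm (@cocycles M p).

Definition HK_class p (z : cocycle p) : HK p := lproj _ z.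

End CohomologyGroup.

Section Cup.
Variables (P Q : bimodule A) (p q : nat).

Definition cup_word (f : cochain p P) (g : cochain q Q) (s : seq V) : btens P Q :=
  if odd p && odd q then
    - \sum_(i < N.-1) \sum_(j < N.-1 | (i + j <= N - 2)%N)
        split_at (i + nu N p + (N - 2 - i - j)) (@pure _ _ P Q)
          (split_at i (@lact _ _ P) wordA
            (split_at (nu N p) (@ract _ _ P) (eval_word f) wordA))
          (split_at (nu N q) (@ract _ _ Q) (eval_word g) wordA) s
  else split_at (nu N p) (@pure _ _ P Q) (eval_word f) (eval_word g) s.

Lemma cup_word_multilinear f g : multilinear (cup_word f g).
Proof.
have wM := wordA_multilinear.
have fM := eval_word_multilinear f; have gM := eval_word_multilinear g.
have pM := multilinear_split _ (@pure_linl _ _ P Q) (@pure_linr _ _ P Q).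
rewrite /cup_word; case: (odd p && odd q); last exact: pM.
apply: multilinear_opp; apply: multilinear_sum => i.
apply: multilinear_sum => j; apply: pM.
  apply: (multilinear_split _ (@lact_linl _ _ P) (@lact_linr _ _ P) wM).
  exact: (multilinear_split _ (@ract_linl _ _ P) (@ract_linr _ _ P) fM wM).
exact: (multilinear_split _ (@ract_linl _ _ Q) (@ract_linr _ _ Q) gM wM).
Qed.

Definition cup (f : cochain p P) (g : cochain q Q) : cochain (p + q) (btens P Q) :=
  onW (nu N (p + q)) (cup_word_multilinear f g).

Definition cup_via (S : lmodType k) (mu : linmap (btens P Q) S)
    (f : cochain p P) (g : cochain q Q) : cochain (p + q) S :=
  mklin (f := mu \o cup f g)
    (fun c u v => etrans (congr1 mu (linmapP (cup f g) c u v)) (linmapP mu c _ _)).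

End Cup.

(* m is the map induced on cohomology by the cup product and the
   identification mu : P (x)_A Q -> S; such an m is unique. *)
Definition induced_by_cup (P Q S : bimodule A) (mu : linmap (btens P Q) S)
    (m : forall p q, HK P p -> HK Q q -> HK S (p + q)%N) : Prop :=
  forall p q (f : cocycle P p) (g : cocycle Q q),
    exists2 h : cocycle S (p + q)%N,
      val h = cup_via mu (val f) (val g)
      & m p q (HK_class f) (HK_class g) = HK_class h.

End Koszul.

Section Graded.
Variable k : fieldType.

Definition gcast (H : nat -> lmodType k) p q (e : p = q) (x : H p) : H q :=
  eq_rect p (fun n => H n) x q e.

Record graded_algebra (H : nat -> lmodType k)
    (mul : forall p q, H p -> H q -> H (p + q)%N) (one : H 0%N) : Prop := {
  ga_linl : forall p q (b : H q), linear (fun a : H p => mul p q a b);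
  ga_linr : forall p q (a : H p), linear (mul p q a);
  ga_assoc : forall p q r (a : H p) (b : H q) (c : H r),
    gcast (addnA p q r) (mul _ _ a (mul _ _ b c)) = mul _ _ (mul _ _ a b) c;
  ga_1l : forall p (a : H p), mul 0%N p one a = a;
  ga_1r : forall p (a : H p), gcast (addn0 p) (mul p 0%N a one) = a
}.

Record graded_bimodule (H : nat -> lmodType k)
    (mul : forall p q, H p -> H q -> H (p + q)%N) (one : H 0%N)
    (K : nat -> lmodType k)
    (lmul : forall p q, H p -> K q -> K (p + q)%N)
    (rmul : forall p q, K p -> H q -> K (p + q)%N) : Prop := {
  gb_linll : forall p q (m : K q), linear (fun a : H p => lmul p q a m);
  gb_linlr : forall p q (a : H p), linear (lmul p q a);
  gb_linrl : forall p q (a : H q), linear (fun m : K p => rmul p q m a);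
  gb_linrr : forall p q (m : K p), linear (rmul p q m);
  gb_lassoc : forall p q r (a : H p) (b : H q) (m : K r),
    gcast (addnA p q r) (lmul _ _ a (lmul _ _ b m)) = lmul _ _ (mul _ _ a b) m;
  gb_rassoc : forall p q r (m : K p) (a : H q) (b : H r),
    gcast (addnA p q r) (rmul _ _ m (mul _ _ a b)) = rmul _ _ (rmul _ _ m a) b;
  gb_lrassoc : forall p q r (a : H p) (m : K q) (b : H r),
    gcast (addnA p q r) (lmul _ _ a (rmul _ _ m b)) = rmul _ _ (lmul _ _ a m) b;
  gb_1l : forall p (m : K p), lmul 0%N p one m = m;
  gb_1r : forall p (m : K p), gcast (addn0 p) (rmul p 0%N m one) = m
}.

End Graded.

(* Main.v *)
Require Import Defs.
From HB Require Import structures.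
From mathcomp Require Import all_boot all_algebra.
From mathcomp Require Import finmap boolp classical_sets functions.
From mathcomp Require Import monalg.
From mathcomp Require Import zify.

Set Implicit Arguments.
Unset Strict Implicit.
Unset Printing Implicit Defensive.

Import GRing.Theory.
Local Open Scope ring_scope.

(** Let e be the map sending a letter to its class in A, and let the juxtaposition
    of functions on words mean: evaluate the first factor on an initial segment
    of the word, the next factor on the following segment, and multiply. With
    n = N - 2, the Koszul differential is F e - e F on even cochains and the sum
    of the e^i F e^j, i + j = n + 1, on odd ones; the cup product is F G, or
    minus the sum of the e^i F e^l G e^j, i + l + j = n, on two odd cochains.
    The relations that are needed all come from sums of this kind telescoping.

    - The Leibniz rule [diffw_cupw] makes the product of two cocycles a cocycle
      and the product of a cocycle with a coboundary a coboundary, so that the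
      cup product descends to cohomology ([cohom_cupl], [cohom_cupr]).

    - On cochains the product need not be associative. On three odd cochains, let
      Phi (F, G, H) be the sum of the e^a F e^b G e^c H e^d over the exponents
      with a + b + c + d = N - 3; on any other ones let it be 0. By [cupwA],
      F (G H) - (F G) H is, up to the signs of the terms, the sum of
      b (Phi (F, G, H)), Phi (b F, G, H), Phi (F, b G, H) and Phi (F, G, b H),
      so the associator of three cocycles is a coboundary.

    - A central element u of a bimodule, such as 1 in A or in k, is a cocycle of
      degree 0, and it is a unit for the product as soon as it is one for the
      coefficients.

    These identities are exact on all words. A cochain, however, only lives on
    the subspace W_p of the p-th tensor power of V, and its values on single
    words are those of an arbitrary extension. The identities can be used
    because W_(i + j) is contained in both W_i (x) V^j and V^i (x) W_j: on
    W_(i + j) the product F G only depends on F on W_i and on G on W_j. This is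
    [agreeW_split], and [eqW] is the resulting congruence on functions on words.

    All the products of the theorem are instances of one product, for a bimodule
    map mu from P (x)_A Q to S; their properties follow from associativity and
    unit laws for such maps on the level of coefficients. *)

(** * Sums over the decompositions of a natural number *)

Section CompositionSums.
Variable Z : zmodType.

Definition csum (n : nat) (h : nat -> nat -> Z) : Z :=
  \sum_(i < n.+1) h i (n - i)%N.

Lemma eq_csum n h h' :
  (forall i j, (i + j)%N = n -> h i j = h' i j) -> csum n h = csum n h'.
Proof. by move=> E; apply: eq_bigr => i _; apply: E; rewrite subnKC // -ltnS. Qed.

Lemma csumC n h : csum n h = csum n (fun i j => h j i).
Proof.
rewrite /csum (reindex_inj rev_ord_inj) /=; apply: eq_bigr => i _.
by rewrite subSS subKn // -ltnS.
Qed.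

Lemma csum0 h : csum 0 h = h 0 0.
Proof. by rewrite /csum big_ord1. Qed.

Lemma csumSl n h : csum n.+1 h = h 0 n.+1 + csum n (fun i j => h i.+1 j).
Proof. by rewrite /csum big_ord_recl subn0; congr (_ + _). Qed.

Lemma csumSr n h : csum n.+1 h = csum n (fun i j => h i j.+1) + h n.+1 0.
Proof. by rewrite csumC csumSl addrC csumC. Qed.

Lemma csumD n h h' : csum n (fun i j => h i j + h' i j) = csum n h + csum n h'.
Proof. exact: big_split. Qed.

Lemma csumN n h : csum n (fun i j => - h i j) = - csum n h.
Proof. exact: sumrN. Qed.

Lemma csumB n h h' : csum n (fun i j => h i j - h' i j) = csum n h - csum n h'.
Proof. by rewrite csumD csumN. Qed.

(** Both sides are the sum over i + l + j = n. Removing the terms with i = 0 from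
    both leaves the same sums for n - 1 and for h shifted in its first index. *)
Lemma csumA n (h : nat -> nat -> nat -> Z) :
  csum n (fun m j => csum m (fun i l => h i l j)) =
  csum n (fun i m => csum m (fun l j => h i l j)).
Proof.
elim: n h => [|n IHn] h; first by rewrite !csum0.
rewrite !csumSl csum0 -IHn -addrA; congr (_ + _).
by rewrite -csumD; apply: eq_csum => i j _; rewrite csumSl.
Qed.

Lemma csum_telescope n (h : nat -> nat -> Z) :
  csum n (fun i j => h i j.+1 - h i.+1 j) = h 0 n.+1 - h n.+1 0.
Proof. by apply/eqP; rewrite csumB subr_eq addrAC -csumSl csumSr addrK. Qed.

Definition csum3 (n : nat) (h : nat -> nat -> nat -> Z) : Z :=
  csum n (fun i m => csum m (h i)).

(** The indices add up to n - 1, and there is no term when n = 0: for n = N - 2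
    these are the exponents with sum N - 3, of which there are none if N = 2. *)
Definition csum4 (n : nat) (h : nat -> nat -> nat -> nat -> Z) : Z :=
  if n is m.+1 then csum m (fun i r => csum3 r (h i)) else 0.

Lemma eq_csum3 n h h' :
  (forall i l j, (i + (l + j))%N = n -> h i l j = h' i l j) ->
  csum3 n h = csum3 n h'.
Proof.
by move=> E; apply: eq_csum => i m im; apply: eq_csum => l j lj; apply: E; rewrite lj.
Qed.

Lemma csum3B n h h' :
  csum3 n (fun i l j => h i l j - h' i l j) = csum3 n h - csum3 n h'.
Proof. by rewrite -csumB; apply: eq_csum => i m _; rewrite csumB. Qed.

Lemma csum3C23 n h : csum3 n h = csum3 n (fun i j l => h i l j).
Proof. by apply: eq_csum => i m _; rewrite csumC. Qed.

Lemma csum3C12 n h : csum3 n h = csum3 n (fun l i j => h i l j).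
Proof.
by rewrite /csum3 -!csumA; apply: eq_csum => m j _; rewrite csumC.
Qed.

Lemma csum3_rot n h : csum3 n h = csum3 n (fun j i l => h i l j).
Proof. by rewrite csum3C23 csum3C12. Qed.

(** For fixed j the sum over i and l telescopes. Both remaining sums run over a
    total of n + 1 with j at most n; the missing terms, at i = l = 0, cancel. *)
Lemma csum3_telescope n h :
  csum3 n (fun i l j => h i l.+1 j - h i.+1 l j) =
  csum n.+1 (h 0) - csum n.+1 (fun i j => h i 0 j).
Proof.
rewrite /csum3 -csumA !csumSl opprD addrACA subrr add0r -csumB.
by apply: eq_csum => m j _; exact: (csum_telescope m (fun i l => h i l j)).
Qed.

Lemma eq_csum4 n h h' :
  (forall a b c d, (a + (b + (c + d))).+1%N = n -> h a b c d = h' a b c d) ->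
  csum4 n h = csum4 n h'.
Proof.
case: n => [//|n] E; apply: eq_csum => a m am; apply: eq_csum3 => b c d bcd.
by apply: E; rewrite bcd am.
Qed.

Lemma csum4B n h h' :
  csum4 n (fun a b c d => h a b c d - h' a b c d) = csum4 n h - csum4 n h'.
Proof.
case: n => [|n]; first by rewrite /= subr0.
by rewrite -[RHS]csumB; apply: eq_csum => i m _; rewrite csum3B.
Qed.

Lemma csum4C23 n h : csum4 n h = csum4 n (fun a c b d => h a b c d).
Proof. by case: n => [//|n]; apply: eq_csum => a m _; rewrite csum3C12. Qed.

Lemma csum4C34 n h : csum4 n h = csum4 n (fun a b d c => h a b c d).
Proof. by case: n => [//|n]; apply: eq_csum => a m _; rewrite csum3C23. Qed.

Lemma csum4C12 n h : csum4 n h = csum4 n (fun b a c d => h a b c d).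
Proof.
case: n => [//|n]; rewrite /= /csum3.
rewrite -(csumA n (fun a b m => csum m (h a b))).
rewrite -(csumA n (fun b a m => csum m (h a b))).
by apply: eq_csum => m j _; rewrite csumC.
Qed.

Lemma csum4_rot n h : csum4 n h = csum4 n (fun d a b c => h a b c d).
Proof. by rewrite csum4C34 csum4C23 csum4C12. Qed.

(** The analogue of [csum3_telescope] in the first two indices. It holds for
    n = 0 as well, where the two sums on the right consist of the same term. *)
Lemma csum4_telescope n h :
  csum4 n (fun a b c d => h a b.+1 c d - h a.+1 b c d) =
  csum3 n (h 0) - csum3 n (fun a c d => h a 0 c d).
Proof.
case: n => [|n]; first by rewrite /csum3 !csum0 subrr.
rewrite [in RHS]/csum3 !csumSl opprD addrACA subrr add0r -csumB /csum4 /csum3.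
rewrite -(csumA n (fun a b m => csum m (fun c d => h a b.+1 c d - h a.+1 b c d))).
apply: eq_csum => m r _.
rewrite -(csum_telescope m (fun a b => csum r (h a b))).
by apply: eq_csum => a b _; rewrite csumB.
Qed.

End CompositionSums.

(** * Pairings of bimodules *)

Section Pairings.
Variables (k : fieldType) (A : algType k).

(** A bimodule map from P (x)_A Q to S. Its bilinearity over A on both sides lets
    the leading and trailing letters of a word move out of a product. *)
Record pairing (P Q S : bimodule A) := Pairing {
  pair_map :> linmap (btens P Q) S;
  pair_lact : forall a p q,
    pair_map (pure (lact a p) q) = lact a (pair_map (pure p q));
  pair_ract : forall p q a,
    pair_map (pure p (ract q a)) = ract (pair_map (pure p q)) a
}.

Definition pair_op (P Q S : bimodule A) (mu : pairing P Q S) (p : P) (q : Q) : S :=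
  mu (pure p q).

Lemma pair_linl P Q S (mu : pairing P Q S) q : linear ((pair_op mu)^~ q).
Proof. by move=> c x y; rewrite /pair_op pure_linl linmapP. Qed.

Lemma pair_linr P Q S (mu : pairing P Q S) p : linear (pair_op mu p).
Proof. by move=> c x y; rewrite /pair_op pure_linr linmapP. Qed.

Lemma pair_balanced P Q S (mu : pairing P Q S) p a q :
  pair_op mu (ract p a) q = pair_op mu p (lact a q).
Proof. by rewrite /pair_op pure_balanced. Qed.

End Pairings.

Section Identifications.
Variables (k : fieldType) (A : algType k).
Local Notation AA := (regular_bimodule A).

Lemma btens_idlE (M : bimodule A) (a : AA) (m : M) : btens_idl M (pure a m) = lact a m.
Proof. exact: btens_liftE. Qed.

Lemma btens_idrE (M : bimodule A) (m : M) (a : AA) : btens_idr M (pure m a) = ract m a.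
Proof. exact: btens_liftE. Qed.

Lemma btens_idl_lact (M : bimodule A) a p (q : M) :
  btens_idl M (pure (lact a p) q) = lact a (btens_idl M (pure p q)).
Proof. by rewrite !btens_idlE lactA. Qed.

Lemma btens_idl_ract (M : bimodule A) p (q : M) a :
  btens_idl M (pure p (ract q a)) = ract (btens_idl M (pure p q)) a.
Proof. by rewrite !btens_idlE lractA. Qed.

Definition pairing_idl (M : bimodule A) : pairing AA M M :=
  Pairing (@btens_idl_lact M) (@btens_idl_ract M).

Lemma btens_idr_lact (M : bimodule A) a (p : M) q :
  btens_idr M (pure (lact a p) q) = lact a (btens_idr M (pure p q)).
Proof. by rewrite !btens_idrE lractA. Qed.

Lemma btens_idr_ract (M : bimodule A) (p : M) q a :
  btens_idr M (pure p (ract q a)) = ract (btens_idr M (pure p q)) a.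
Proof. by rewrite !btens_idrE ractA. Qed.

Definition pairing_idr (M : bimodule A) : pairing M AA M :=
  Pairing (@btens_idr_lact M) (@btens_idr_ract M).

Variable e : linmap A k^o.
Hypothesis e1 : e 1 = 1.
Hypothesis eM : forall a b, e (a * b) = e a * e b.
Local Notation kk := (aug_bimodule e1 eM).

Lemma btens_idkE (c d : kk) : btens_idk e1 eM (pure c d) = (c : k) * (d : k).
Proof. exact: btens_liftE. Qed.

Lemma btens_idk_lact a (p q : kk) :
  btens_idk e1 eM (pure (lact a p) q) =
  lact a (btens_idk e1 eM (pure p q) : kk).
Proof. by rewrite !btens_idkE /= mulrA. Qed.

Lemma btens_idk_ract (p q : kk) a :
  btens_idk e1 eM (pure p (ract q a)) =
  ract (btens_idk e1 eM (pure p q) : kk) a.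
Proof. by rewrite !btens_idkE /= mulrCA. Qed.

Definition pairing_idk : pairing kk kk kk := Pairing btens_idk_lact btens_idk_ract.

End Identifications.

(** * Linear maps and sums *)

Section LinearSums.
Variables (k : fieldType) (L M : lmodType k) (f : L -> M).
Hypothesis fL : linear f.

Lemma linear_fun0 : f 0 = 0.
Proof. by have := fL (-1) 0 0; rewrite scaler0 addr0 scaleN1r addNr. Qed.
Lemma linear_funD x y : f (x + y) = f x + f y.
Proof. by have := fL 1 x y; rewrite !scale1r. Qed.
Lemma linear_funN x : f (- x) = - f x.
Proof. by have := fL (-1) x 0; rewrite linear_fun0 !addr0 !scaleN1r. Qed.
Lemma linear_funB x y : f (x - y) = f x - f y.
Proof. by rewrite linear_funD linear_funN. Qed.
Lemma linear_csum n h : f (csum n h) = csum n (fun i j => f (h i j)).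
Proof. exact: (big_morph f linear_funD linear_fun0). Qed.
End LinearSums.

Section LinearFunctions.
Variable k : fieldType.

Lemma csum_linear_fun (L L' : lmodType k) m (h : nat -> nat -> L -> L') :
  (forall i j, linear (h i j)) -> linear (fun x => csum m (fun i j => h i j x)).
Proof.
move=> hL c x y; rewrite /csum scaler_sumr -big_split /=.
by apply: eq_bigr => i _; exact: hL.
Qed.

Lemma csum3_linear_fun (L L' : lmodType k) m (h : nat -> nat -> nat -> L -> L') :
  (forall i l j, linear (h i l j)) -> linear (fun x => csum3 m (fun i l j => h i l j x)).
Proof. by move=> hL; apply: csum_linear_fun => i r; exact: csum_linear_fun. Qed.

Lemma linear_opp_fun (L L' : lmodType k) (f : L -> L') :
  linear f -> linear (fun x => - f x).
Proof. by move=> fL c x y; rewrite fL opprD scalerN. Qed.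

Lemma linear_comp_fun (L L' L'' : lmodType k) (f : L' -> L'') (g : L -> L') :
  linear f -> linear g -> linear (fun x => f (g x)).
Proof. by move=> fL gL c x y; rewrite gL fL. Qed.

End LinearFunctions.

(** * Products, differential and cup product of functions on words *)

Section Calculus.
Variables (k : fieldType) (A : algType k) (V : lmodType k).
Variable w : seq V -> A.
Hypothesis w_nil : w [::] = 1.
Hypothesis w_cat : forall s t, w (s ++ t) = w s * w t.
Implicit Types P Q S M : bimodule A.

(** The functions representing the right A-linear maps on V^p (x) A. A linear map
    on V^p corresponds to its right linear extension, so that F and F e^j are the
    same function and trailing powers of e need not be written. *)
Definition right_linear M (p : nat) (F : seq V -> M) :=
  forall s, F s = ract (F (take p s)) (w (drop p s)).

(** The product e^i F. *)
Definition lmulw M (i : nat) (F : seq V -> M) : seq V -> M :=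
  split_at i (@lact _ _ M) w F.

Definition prodw P Q S (mu : pairing P Q S) p (F : seq V -> P) (G : seq V -> Q) :=
  split_at p (pair_op mu) F G.

Lemma take_prefix i j (s : seq V) : take i (take (i + j) s) = take i s.
Proof. by rewrite take_takel ?leq_addr. Qed.

Lemma drop_prefix i j (s : seq V) : drop i (take (i + j) s) = take j (drop i s).
Proof. by rewrite take_drop addnC. Qed.

Lemma drop_addn i j (s : seq V) : drop (i + j) s = drop j (drop i s).
Proof. by rewrite drop_drop addnC. Qed.

Lemma split_atA (L1 L2 L3 L12 L23 L : Type) i j
    (B : L1 -> L23 -> L) (C : L2 -> L3 -> L23)
    (B' : L12 -> L3 -> L) (C' : L1 -> L2 -> L12)
    (F : seq V -> L1) (G : seq V -> L2) (H : seq V -> L3) (s : seq V) :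
  (forall x y z, B x (C y z) = B' (C' x y) z) ->
  split_at i B F (split_at j C G H) s =
  split_at (i + j) B' (split_at i C' F G) H s :> L.
Proof. by move=> BC; rewrite /split_at BC take_prefix drop_prefix drop_addn. Qed.

Lemma lmulw0 M (F : seq V -> M) : lmulw 0 F = F.
Proof. by apply/funext => s; rewrite /lmulw /split_at take0 drop0 w_nil lact1. Qed.

Lemma lmulw_lmulw M i j (F : seq V -> M) :
  lmulw i (lmulw j F) = lmulw (i + j) F.
Proof.
apply/funext => s; rewrite /lmulw /split_at -lactA -w_cat drop_addn; congr (lact (w _) _).
by rewrite -(take_prefix i j) -drop_prefix cat_take_drop.
Qed.

Lemma lmulw_prodw P Q S (mu : pairing P Q S) i p F G :
  lmulw i (prodw mu p F G) = prodw mu (i + p) (lmulw i F) G.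
Proof. by apply/funext => s; apply: split_atA => a x y; rewrite /pair_op pair_lact. Qed.

(** The l letters between the two factors may act on the first one, which is then
    of degree p + l, or on the second one: the pairing is balanced over A. *)
Lemma prodw_widen P Q S (mu : pairing P Q S) p l F G : right_linear p F ->
  prodw mu (p + l) F G = prodw mu p F (lmulw l G).
Proof.
move=> Fp; apply/funext => s; rewrite /prodw /lmulw /split_at Fp pair_balanced.
by rewrite take_prefix drop_prefix drop_addn.
Qed.

Lemma right_linear_widen M p l (F : seq V -> M) : right_linear p F -> right_linear (p + l) F.
Proof.
move=> Fp s; rewrite Fp [in RHS]Fp take_prefix -ractA -w_cat drop_prefix.
by rewrite drop_addn cat_take_drop.
Qed.

Lemma right_linear_lmulw M i p (F : seq V -> M) :
  right_linear p F -> right_linear (i + p) (lmulw i F).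
Proof.
move=> Fp s; rewrite /lmulw /split_at Fp -lractA.
by rewrite take_prefix drop_prefix drop_addn.
Qed.

Lemma right_linear_prodw P Q S (mu : pairing P Q S) p q F G :
  right_linear q G -> right_linear (p + q) (prodw mu p F G).
Proof.
move=> Gq s; rewrite /prodw /split_at Gq {1}/pair_op pair_ract.
by rewrite take_prefix drop_prefix drop_addn.
Qed.

Lemma prodwA P1 P2 P3 P12 P23 S (mu : pairing P1 P23 S) (mu23 : pairing P2 P3 P23)
    (mu' : pairing P12 P3 S) (mu12 : pairing P1 P2 P12) p q F G H :
  (forall x y z, pair_op mu x (pair_op mu23 y z) = pair_op mu' (pair_op mu12 x y) z) ->
  prodw mu p F (prodw mu23 q G H) = prodw mu' (p + q) (prodw mu12 p F G) H.
Proof. by move=> E; apply/funext => s; apply: split_atA. Qed.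

Lemma lmulw_linear M i : linear (@lmulw M i).
Proof. by move=> c F G; apply/funext => s; rewrite /lmulw /split_at lact_linr. Qed.

Lemma prodw_linl P Q S (mu : pairing P Q S) p G : linear ((prodw mu p)^~ G).
Proof. by move=> c F F'; apply/funext => s; rewrite /prodw /split_at pair_linl. Qed.

Lemma prodw_linr P Q S (mu : pairing P Q S) p F : linear (prodw mu p F).
Proof. by move=> c G G'; apply/funext => s; rewrite /prodw /split_at pair_linr. Qed.

Lemma lmulw_csum M i r h :
  @lmulw M i (csum r h) = csum r (fun a b => lmulw i (h a b)).
Proof. exact: (linear_csum (@lmulw_linear M i)). Qed.

Lemma lmulwN M i F : @lmulw M i (- F) = - lmulw i F.
Proof. exact: (linear_funN (@lmulw_linear M i)). Qed.

Lemma lmulwB M i F G : @lmulw M i (F - G) = lmulw i F - lmulw i G.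
Proof. exact: (linear_funB (@lmulw_linear M i)). Qed.

Section ProdLinear.
Variables (P Q S : bimodule A) (mu : pairing P Q S).

Lemma prodw_csuml p r h G :
  prodw mu p (csum r h) G = csum r (fun a b => prodw mu p (h a b) G).
Proof. exact: (linear_csum (prodw_linl mu p G)). Qed.

Lemma prodw_csumr p F r h :
  prodw mu p F (csum r h) = csum r (fun a b => prodw mu p F (h a b)).
Proof. exact: (linear_csum (prodw_linr mu p F)). Qed.

Lemma prodwNl p F G : prodw mu p (- F) G = - prodw mu p F G.
Proof. exact: (linear_funN (prodw_linl mu p G)). Qed.

Lemma prodwNr p F G : prodw mu p F (- G) = - prodw mu p F G.
Proof. exact: (linear_funN (prodw_linr mu p F)). Qed.

Lemma prodwBl p F F' G : prodw mu p (F - F') G = prodw mu p F G - prodw mu p F' G.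
Proof. exact: (linear_funB (prodw_linl mu p G)). Qed.

Lemma prodwBr p F G G' : prodw mu p F (G - G') = prodw mu p F G - prodw mu p F G'.
Proof. exact: (linear_funB (prodw_linr mu p F)). Qed.
End ProdLinear.

Variable n : nat.

(** The Koszul differential for N = n + 2, on odd functions if o holds. The
    factors e^j on the right are implicit, by right linearity. *)
Definition diffw M (o : bool) (F : seq V -> M) : seq V -> M :=
  if o then csum n.+1 (fun i _ => lmulw i F) else F - lmulw 1 F.

Arguments diffw : simpl never.

(** The degree nu (p + 1) - nu p of the differential, in terms of the parity of p. *)
Definition dstep (o : bool) : nat := if o then n.+1 else 1%N.

(** The cup product, with o1 and o2 the parities of F and G. The third exponent
    n - i - l, to the right of G, is implicit. *)
Definition cupw P Q S (mu : pairing P Q S) (o1 o2 : bool) p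
    (F : seq V -> P) (G : seq V -> Q) : seq V -> S :=
  if o1 && o2 then
    - csum3 n (fun i l _ => lmulw i (prodw mu p F (lmulw l G)))
  else prodw mu p F G.

Lemma lmulw_csum3 M i r h :
  @lmulw M i (csum3 r h) = csum3 r (fun a b c => lmulw i (h a b c)).
Proof.
by rewrite lmulw_csum; apply: eq_csum => a m _; rewrite lmulw_csum.
Qed.

(** Two even factors: the commutator with e is a derivation. Otherwise every term
    is some e^i F e^l G e^j. If exactly one factor is odd, its
    differential and that of the product compare terms with i = 0, l = 0 or
    j = 0, and commutators with e move one e across the even factor; if both are
    odd, the commutator with the product moves one e from the right end to the
    left end. In each case this is one telescoping sum. *)
Lemma diffw_cupw P Q S (mu : pairing P Q S) o1 o2 p F G : right_linear p F ->
  diffw (o1 (+) o2) (cupw mu o1 o2 p F G) =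
  cupw mu (~~ o1) o2 (p + dstep o1) (diffw o1 F) G
  + (-1) ^+ o1 *: cupw mu o1 (~~ o2) p F (diffw o2 G).
Proof.
move=> Fp; pose T i l := lmulw i (prodw mu p F (lmulw l G)).
have T0 l : prodw mu p F (lmulw l G) = T 0%N l by rewrite /T lmulw0.
have T00 : prodw mu p F G = T 0%N 0%N by rewrite /T !lmulw0.
have TS i l : lmulw 1 (T i l) = T i.+1 l by rewrite /T lmulw_lmulw.
have TF i l : prodw mu (i + (p + l)) (lmulw i F) G = T i l.
  by rewrite -lmulw_prodw prodw_widen.
have DFG : prodw mu (p + n.+1) (csum n.+1 (fun i _ => lmulw i F)) G = csum n.+1 T.
  by rewrite prodw_csuml; apply: eq_csum => i l <-; rewrite addnCA TF.
have FDG : prodw mu p F (csum n.+1 (fun i _ => lmulw i G)) =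
    csum n.+1 (fun l _ => T 0%N l).
  by rewrite prodw_csumr; apply: eq_csum => l j _; exact: T0.
have DP : csum n.+1 (fun i _ => lmulw i (prodw mu p F G)) =
    csum n.+1 (fun i _ => T i 0%N).
  by apply: eq_csum => i j _; rewrite /T lmulw0.
case: o1; case: o2; rewrite /cupw /diffw /dstep ?expr0 ?expr1 ?scaleN1r ?scale1r.
- rewrite DFG FDG lmulwN opprK lmulw_csum3.
  have -> : csum n.+1 (fun l _ => T 0%N l) = csum n.+1 (fun _ l => T 0%N l).
    exact: csumC.
  rewrite addrC -[LHS]opprB -[RHS]opprB; congr (- _).
  rewrite -(csum3_telescope n (fun i j l => T i l)) -csum3B csum3C23.
  by apply: eq_csum3 => i j l _; rewrite TS.
- have FlB l : lmulw l (G - lmulw 1 G) = lmulw l G - lmulw l.+1 G.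
    by rewrite lmulwB lmulw_lmulw addn1.
  rewrite DFG DP opprK (csumC _ T) (csumC _ (fun i _ => T i 0%N)).
  apply/eqP; rewrite addrC -subr_eq; apply/eqP.
  rewrite -(csum3_telescope n (fun l j i => T i l)) [RHS]csum3C12 [RHS]csum3C23.
  by apply: eq_csum3 => l j i _; rewrite FlB prodwBr lmulwB.
- rewrite FDG DP; apply/eqP; rewrite -subr_eq; apply/eqP.
  rewrite -[LHS]opprB; congr (- _).
  rewrite -(csum3_telescope n (fun i l j => T i l)).
  apply: eq_csum3 => i l j _.
  rewrite prodwBl prodw_widen // lmulw_lmulw [(p + 1)%N]addnC -lmulw_prodw lmulwB.
  by rewrite lmulw_lmulw addn1.
- rewrite prodwBl prodwBr prodw_widen // addnC -lmulw_prodw T00.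
  by rewrite [RHS]addrC addrA subrK.
Qed.

Lemma lmulw_csum4 M i r h :
  @lmulw M i (csum4 r h) = csum4 r (fun a b c d => lmulw i (h a b c d)).
Proof.
case: r => [|r]; first exact: (linear_fun0 (@lmulw_linear M i)).
by rewrite lmulw_csum; apply: eq_csum => a m _; rewrite lmulw_csum3.
Qed.

Lemma prodw_csum3l P Q S (mu : pairing P Q S) p r h G :
  prodw mu p (csum3 r h) G = csum3 r (fun a b c => prodw mu p (h a b c) G).
Proof.
by rewrite prodw_csuml; apply: eq_csum => a m _; rewrite prodw_csuml.
Qed.

Lemma prodw_csum3r P Q S (mu : pairing P Q S) p F r h :
  prodw mu p F (csum3 r h) = csum3 r (fun a b c => prodw mu p F (h a b c)).
Proof.
by rewrite prodw_csumr; apply: eq_csum => a m _; rewrite prodw_csumr.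
Qed.

Section Associator.
Variables (P1 P2 P3 P12 P23 S : bimodule A).
Variables (mu : pairing P1 P23 S) (mu23 : pairing P2 P3 P23).
Variables (mu' : pairing P12 P3 S) (mu12 : pairing P1 P2 P12).
Hypothesis muA : forall x y z,
  pair_op mu x (pair_op mu23 y z) = pair_op mu' (pair_op mu12 x y) z.

(** The sum of the e^a F e^b G e^c H e^d with a + b + c + d = N - 3, on three odd
    functions. It is the homotopy for the associativity of the cup product. *)
Definition assoc_homotopy (o1 o2 o3 : bool) p q
    (F : seq V -> P1) (G : seq V -> P2) (H : seq V -> P3) : seq V -> S :=
  if [&& o1, o2 & o3] then
    csum4 n (fun a b c _ =>
      lmulw a (prodw mu p F (lmulw b (prodw mu23 q G (lmulw c H)))))
  else 0.

Definition cup_width (o1 o2 : bool) (p q : nat) : nat :=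
  (p + q + (if o1 && o2 then n else 0))%N.

(** With at most one odd function, both triple products are F G H. With two odd
    ones, the two triple products differ in the side of the even function on
    which a power of e stands, so that the associator is a sum of terms in which
    this function is replaced by its commutator with e. With three, F (G H) collects the terms e^a F e^b G e^c H e^d
    with a = 0 and (F G) H those with d = 0, and their difference is the
    commutator of the homotopy with e. *)
Lemma cupwA o1 o2 o3 p q F G H : right_linear p F -> right_linear q G ->
  cupw mu o1 (o2 (+) o3) p F (cupw mu23 o2 o3 q G H)
  - cupw mu' (o1 (+) o2) o3 (cup_width o1 o2 p q) (cupw mu12 o1 o2 p F G) H =
  - (diffw (~~ (o1 (+) o2 (+) o3)) (assoc_homotopy o1 o2 o3 p q F G H)
     + assoc_homotopy (~~ o1) o2 o3 (p + dstep o1) q (diffw o1 F) G H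
     + (-1) ^+ o1 *: assoc_homotopy o1 (~~ o2) o3 p (q + dstep o2) F (diffw o2 G) H
     + (-1) ^+ (o1 (+) o2) *: assoc_homotopy o1 o2 (~~ o3) p q F G (diffw o3 H)).
Proof.
move=> Fp Gq.
pose T a b c := lmulw a (prodw mu p F (lmulw b (prodw mu23 q G (lmulw c H)))).
have TE a b c :
  lmulw a (prodw mu p F (lmulw b (prodw mu23 q G (lmulw c H)))) = T a b c by [].
have TE0 b c : prodw mu p F (lmulw b (prodw mu23 q G (lmulw c H))) = T 0%N b c.
  by rewrite -TE lmulw0.
have T0E a c : lmulw a (prodw mu p F (prodw mu23 q G (lmulw c H))) = T a 0%N c.
  by rewrite -TE lmulw0.
have TE_0 a b : lmulw a (prodw mu p F (lmulw b (prodw mu23 q G H))) = T a b 0%N.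
  by rewrite -TE lmulw0.
have TS a b c : lmulw 1 (T a b c) = T a.+1 b c by rewrite -TE lmulw_lmulw.
clearbody T.
have pA r K L X :
    prodw mu' (p + r) (prodw mu12 p K L) X = prodw mu p K (prodw mu23 r L X).
  by rewrite (prodwA _ _ _ _ _ muA).
have FG_H : prodw mu' (p + q + n)
    (csum3 n (fun a b _ => lmulw a (prodw mu12 p F (lmulw b G)))) H = csum3 n T.
  rewrite prodw_csum3l; apply: eq_csum3 => a b c abc.
  have -> : (p + q + n = a + (p + (b + (q + c))))%N.
    by rewrite -abc -addnA (addnCA q) (addnCA q) addnCA.
  by rewrite -lmulw_prodw pA -lmulw_prodw prodw_widen.
have F_GH : prodw mu p F (csum3 n (fun b c _ => lmulw b (prodw mu23 q G (lmulw c H)))) =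
    csum3 n (fun b c _ => T 0%N b c).
  by rewrite prodw_csum3r; apply: eq_csum3 => b c d _; exact: TE0.
have FoGH : csum3 n (fun a b _ => lmulw a (prodw mu p F (lmulw b (prodw mu23 q G H)))) =
    csum3 n (fun a b _ => T a b 0%N).
  by apply: eq_csum3 => a b d _; exact: TE_0.
have FGoH : csum3 n (fun a c _ =>
      lmulw a (prodw mu' (p + q) (prodw mu12 p F G) (lmulw c H))) =
    csum3 n (fun a c _ => T a 0%N c).
  by apply: eq_csum3 => a c d _; rewrite pA; exact: T0E.
have D0 o : diffw o (0 : seq V -> S) = 0.
  rewrite /diffw; case: o.
    by rewrite /csum big1 // => i _; exact: (linear_fun0 (@lmulw_linear _ _)).
  by rewrite (linear_fun0 (@lmulw_linear _ _)) subr0.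
rewrite /assoc_homotopy /cup_width.
case: o1; case: o2; case: o3;
  rewrite /= ?D0 ?scaler0 ?addr0 ?add0r ?scale1r ?scaleN1r /cupw /dstep /diffw /=.
- (* three odd functions: telescope between the exponents a and d *)
  rewrite prodwNr prodwNl FG_H F_GH -opprD; congr (- _).
  have -> : csum3 n (fun b c _ => T 0%N b c) = csum3 n (fun _ b c => T 0%N b c).
    exact: csum3_rot.
  rewrite -(csum4_telescope n (fun a d b c => T a b c)) lmulw_csum4 -csum4B.
  rewrite [RHS]csum4C34 [RHS]csum4C23.
  by apply: eq_csum4 => a d b c _; rewrite TE TS.
- (* H even: telescope between c and d *)
  rewrite prodwNl FG_H FoGH -opprD; congr (- _).
  have -> : csum3 n (fun a b _ => T a b 0%N) = csum3 n (fun _ a b => T a b 0%N).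
    exact: csum3_rot.
  rewrite (csum3_rot n T) -(csum4_telescope n (fun c d a b => T a b c)).
  rewrite [RHS]csum4_rot [RHS]csum4_rot; apply: eq_csum4 => c d a b _.
  rewrite !(lmulwB, prodwBr) lmulw_lmulw addn1.
  by congr (_ - _); rewrite -TE.
- (* G even: telescope between b and c *)
  rewrite addn0 FGoH FoGH -opprD; congr (- _); rewrite -[LHS]opprB; congr (- _).
  have -> : csum3 n (fun a c _ => T a 0%N c) = csum3 n (fun c a _ => T a 0%N c).
    exact: csum3C12.
  have -> : csum3 n (fun a b _ => T a b 0%N) = csum3 n (fun b a _ => T a b 0%N).
    exact: csum3C12.
  rewrite -(csum4_telescope n (fun b c a d => T a b c)).
  rewrite [RHS]csum4C12 [RHS]csum4C23; apply: eq_csum4 => b c a d _.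
  rewrite prodwBl prodw_widen // lmulw_lmulw add1n [(q + 1)%N]addnC -lmulw_prodw.
  rewrite lmulwB lmulw_lmulw addn1 prodwBr lmulwB.
  by congr (_ - _); rewrite -TE.
- by rewrite addn0 pA subrr oppr0.
- (* F even: telescope between a and b *)
  rewrite addn0 prodwNr F_GH FGoH -opprD; congr (- _).
  rewrite -(csum4_telescope n (fun a b c _ => T a b c)); apply: eq_csum4 => a b c d _.
  rewrite prodwBl prodw_widen // lmulw_lmulw add1n [(p + 1)%N]addnC -lmulw_prodw.
  by rewrite lmulwB lmulw_lmulw addn1 !TE.
- by rewrite addn0 pA subrr oppr0.
- by rewrite addn0 pA subrr oppr0.
- by rewrite addn0 pA subrr oppr0.
Qed.
End Associator.
End Calculus.

(** * Linearity of the differential and of the cup product *)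

Section LinearCalculus.
Variables (k : fieldType) (A : algType k) (V : lmodType k).
Variables (w : seq V -> A) (n : nat).
Implicit Types P Q S M : bimodule A.

Lemma diffw_linear M o : linear (@diffw _ _ _ w n M o).
Proof.
rewrite /diffw; case: o.
  by apply: csum_linear_fun => i j; exact: lmulw_linear.
move=> c F G; rewrite (@lmulw_linear _ _ _ w M 1 c F G).
by rewrite scalerBr opprD addrACA.
Qed.

Lemma diffwZ M o c (F : seq V -> M) : diffw w n o (c *: F) = c *: diffw w n o F.
Proof.
by have L := @diffw_linear M o; have := L c F 0; rewrite (linear_fun0 L) !addr0.
Qed.

Lemma cupw_linl P Q S (mu : pairing P Q S) o1 o2 p G :
  linear (fun F => cupw w n mu o1 o2 p F G).
Proof.
rewrite /cupw; case: (o1 && o2); last exact: prodw_linl.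
pose h i l (_ : nat) F := lmulw w i (prodw mu p F (lmulw w l G)).
apply: (linear_opp_fun (f := fun F => csum3 n (fun i l j => h i l j F))).
apply: (csum3_linear_fun n (h := h)) => i l j.
exact: (linear_comp_fun (@lmulw_linear _ _ _ w S i) (prodw_linl mu p _)).
Qed.

Lemma cupw_linr P Q S (mu : pairing P Q S) o1 o2 p F :
  linear (fun G => cupw w n mu o1 o2 p F G).
Proof.
rewrite /cupw; case: (o1 && o2); last exact: prodw_linr.
pose h i l (_ : nat) G := lmulw w i (prodw mu p F (lmulw w l G)).
apply: (linear_opp_fun (f := fun G => csum3 n (fun i l j => h i l j G))).
apply: (csum3_linear_fun n (h := h)) => i l j.
exact: (linear_comp_fun (@lmulw_linear _ _ _ w S i)
  (linear_comp_fun (prodw_linr mu p F) (@lmulw_linear _ _ _ w Q l))).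
Qed.

Lemma cupw0l P Q S (mu : pairing P Q S) o1 o2 p G : cupw w n mu o1 o2 p 0 G = 0.
Proof. exact: (linear_fun0 (cupw_linl mu o1 o2 p G)). Qed.

Lemma cupw0r P Q S (mu : pairing P Q S) o1 o2 p F : cupw w n mu o1 o2 p F 0 = 0.
Proof. exact: (linear_fun0 (cupw_linr mu o1 o2 p F)). Qed.

Section AssocHomotopy.
Variables (P1 P2 P3 P23 S : bimodule A).
Variables (mu : pairing P1 P23 S) (mu23 : pairing P2 P3 P23) (o1 o2 o3 : bool).

Lemma assoc_homotopy0 p q F G H : [\/ F = 0, G = 0 | H = 0] ->
  assoc_homotopy w n mu mu23 o1 o2 o3 p q F G H = 0.
Proof.
rewrite /assoc_homotopy; case: ifP => // _ FGH.
have lw0 M i : lmulw w i (0 : seq V -> M) = 0.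
  exact: (linear_fun0 (@lmulw_linear _ _ _ _ _ _)).
have pl0 P Q T (nu : pairing P Q T) i K : prodw (V := V) nu i 0 K = 0.
  exact: (linear_fun0 (prodw_linl nu i K)).
have pr0 P Q T (nu : pairing P Q T) i K : prodw (V := V) nu i K 0 = 0.
  exact: (linear_fun0 (prodw_linr nu i K)).
rewrite -(subrr (csum4 n (fun _ _ _ _ => 0 : seq V -> S))) -csum4B.
apply: eq_csum4 => a b c d _; rewrite subrr.
by case: FGH => ->; rewrite ?(lw0, pl0, pr0).
Qed.

End AssocHomotopy.
End LinearCalculus.

(** * Linear maps vanishing on an intersection *)

Section SubspaceMaps.
Variables (k : fieldType) (U M : lmodType k).

(** Modulo S2, the restriction of F to S1 is well defined because F vanishes on
    the intersection; G is an extension of it to the whole quotient by S2. *)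
Lemma linmap_interpolate (S1 S2 : submodClosed U) (F : linmap U M) :
  (forall x, x \in S1 -> x \in S2 -> F x = 0) ->
  exists G : linmap U M,
    (forall x, x \in S1 -> G x = F x) /\ (forall x, x \in S2 -> G x = 0).
Proof.
move=> F0.
pose I : {pred lquot S2} := fun y => `[< exists2 x, x \in S1 & y = lproj S2 x >].
have IP : submod_closed I.
  split=> [|c _ _ /asboolP[x xS ->] /asboolP[y yS ->]]; apply/asboolP.
    by exists 0; rewrite ?rpred0 ?lproj0.
  by exists (c *: x + y); rewrite ?rpredD ?rpredZ // lproj_linear.
pose IC : submodClosed (lquot S2) :=
  HB.pack I (GRing.isSubmodClosed.Build k (lquot S2) I IP).
have pre (y : subm IC) : exists2 x, x \in S1 & val y = lproj S2 x.
  by case: y => y /= /asboolP.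
have [r rP] := choice (fun y => let: ex_intro2 x xS yx := pre y in
  ex_intro (fun x => x \in S1 /\ val y = lproj S2 x) x (conj xS yx)).
have FE (y : subm IC) x : x \in S1 -> val y = lproj S2 x -> F (r y) = F x.
  move=> xS yx; have [rS ry] := rP y.
  apply/eqP; rewrite -subr_eq0 -linearB /=; apply/eqP; apply: F0.
    by rewrite rpredD // -scaleN1r rpredZ.
  by rewrite -lprojE -ry yx.
have rL : linear (F \o r).
  move=> c x y; rewrite /= -linmapP; apply: FE.
    by rewrite rpredD ?rpredZ ?(rP _).1.
  by rewrite lproj_linear -(rP x).2 -(rP y).2.
have gL : linear (extend (mklin rL) \o lproj S2).
  by move=> c x y; rewrite /= lproj_linear linmapP.
exists (mklin gL); split=> x xS /=.
  have xI : lproj S2 x \in IC by apply/asboolP; exists x.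
  rewrite -[lproj S2 x]/(val (Subm xI)) extendE /=; exact: FE.
have -> : lproj S2 x = 0 by apply/eqP; rewrite lproj_eq0.
exact: linear0.
Qed.

(** Dual form of the fact that the tensor product with a vector space commutes
    with finite intersections: it lets F (x) G be shown to vanish on the
    intersection of the S_t (x) L by treating one S_t at a time. *)
Lemma linmap_decompose m (S : nat -> submodClosed U) (F : linmap U M) :
  (forall x, (forall t, (t < m)%N -> x \in S t) -> F x = 0) ->
  exists G : nat -> linmap U M, (forall x, F x = \sum_(t < m) G t x) /\
    forall t x, (t < m)%N -> x \in S t -> G t x = 0.
Proof.
elim: m F => [|m IHm] F F0.
  by exists (fun=> 0); split=> // x; rewrite big_ord0 F0.
pose I : {pred U} := fun x => `[< forall t, (t < m)%N -> x \in S t >].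
have IP : submod_closed I.
  split=> [|c x y /asboolP xI /asboolP yI]; apply/asboolP => t tm.
    exact: rpred0.
  by rewrite rpredD ?rpredZ ?xI ?yI.
pose IC : submodClosed U := HB.pack I (GRing.isSubmodClosed.Build k U I IP).
have [x /asboolP xI xS|G1 [G1F G10]] := @linmap_interpolate IC (S m) F.
  by apply: F0 => t; rewrite ltnS leq_eqVlt => /orP[/eqP -> //|]; exact: xI.
have dL : linear (fun x => F x - G1 x).
  by move=> c x y; rewrite !linmapP scalerBr opprD addrACA.
have [x xI|G [GE G0]] := IHm (mklin dL).
  by rewrite /= G1F ?subrr //; apply/asboolP.
exists (fun t => if t == m then G1 else G t); split=> [x|t x].
  rewrite big_ord_recr /= eqxx; apply/eqP; rewrite -subr_eq; apply/eqP.
  rewrite -[LHS]/(mklin dL x) GE; apply: eq_bigr => t _.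
  by rewrite ifN // neq_ltn ltn_ord.
rewrite ltnS leq_eqVlt; case: eqP => [-> _|_ /= tm]; [exact: G10|exact: G0].
Qed.

End SubspaceMaps.

(** * The spaces W_p inside tensor products *)

Section WordSubspaces.
Variables (k : fieldType) (V : lmodType k) (N : nat) (R : relspace V N).
Local Notation T := (tensor_alg V).
Local Notation word := (@word k V).

Definition relword (a b : nat) : set T :=
  [set y | exists u r v,
     [/\ u \in tpow V a, r \in rels R, v \in tpow V b & y = u * r * v]]%classic.

Lemma WsubP p x :
  reflect (x \in tpow V p /\
           forall a b, (a + N + b)%N = p -> x \in lspan (relword a b))
          (x \in Wsub R p).
Proof. exact: asboolP. Qed.

Lemma word_tpow s : word s \in tpow V (size s).
Proof. by apply: mem_lspan; exists s. Qed.

Lemma word_take_tpow i j s : size s = (i + j)%N -> word (take i s) \in tpow V i.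
Proof.
by move=> sij; have := word_tpow (take i s); rewrite size_takel // sij leq_addr.
Qed.

Lemma word_drop_tpow i j s : size s = (i + j)%N -> word (drop i s) \in tpow V j.
Proof. by move=> sij; have := word_tpow (drop i s); rewrite size_drop sij addKn. Qed.

Lemma tpow_ind (L : lmodType k) (f : T -> L) n : linear f ->
  (forall s, size s = n -> f (word s) = 0) -> forall x, x \in tpow V n -> f x = 0.
Proof.
by move=> fL f0 x; apply: (lspan_ker (f := mklin fL)) => _ [s sn ->]; exact: f0.
Qed.

Lemma tpowM a b x y : x \in tpow V a -> y \in tpow V b -> x * y \in tpow V (a + b).
Proof.
move=> xa yb; rewrite -lproj_eq0; apply/eqP.
have lL z : linear (fun x => lproj (tpow V (a + b)) (x * z)).
  by move=> c u v; rewrite mulrDl -scalerAl lproj_linear.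
have lR z : linear (fun y => lproj (tpow V (a + b)) (z * y)).
  by move=> c u v; rewrite mulrDr -scalerAr lproj_linear.
refine (tpow_ind (lL y) (fun s sa => _) xa).
refine (tpow_ind (lR (word s)) (fun t tb => _) yb).
by apply/eqP; rewrite lproj_eq0 -word_cat -sa -tb -size_cat word_tpow.
Qed.

Section Vanishing.
Variables (L1 L2 L : lmodType k) (B : L1 -> L2 -> L).
Hypothesis B_linl : forall y, linear (B^~ y).
Hypothesis B_linr : forall x, linear (B x).
Variables (i j : nat).

Lemma linmap_word_multilinear (M : lmodType k) (z : linmap T M) :
  multilinear (z \o word).
Proof. exact: multilinear_word. Qed.

Lemma tlift_word (M : lmodType k) (z : linmap T M) (zM : multilinear (z \o word)) x :
  tlift zM x = z x.
Proof. exact: tlift_unique. Qed.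

(** W_p is the intersection of V^p with the subspaces V^a R V^b, a + N + b = p. *)
Lemma W_decompose (M : lmodType k) p (z : linmap T M) :
  (forall x, x \in Wsub R p -> z x = 0) ->
  exists m (G : nat -> linmap T M), (forall x, z x = \sum_(t < m) G t x) /\
    forall t, (t < m)%N ->
      (forall x, x \in tpow V p -> G t x = 0) \/
      exists a b, (a + N + b)%N = p /\ forall x, x \in lspan (relword a b) -> G t x = 0.
Proof.
move=> z0.
(* index 0 stands for V^p and index a + 1 for the relations in position a, or
   again for V^p when there is no room for them in that position *)
pose X t : set T := if t is a.+1 then
    if (a + N <= p)%N then relword a (p - (a + N)) else [set y | y \in tpow V p]%classic
  else [set y | y \in tpow V p]%classic.
have [|G [zG G0]] := @linmap_decompose _ _ _ p.+2 (fun t => lspan (X t)) z.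
  move=> x xX; apply: z0; apply/WsubP; split=> [|a b abp].
    by apply: (lspanP _ _ (xX 0%N _) (tpow V p)).
  have := xX a.+1; rewrite /X -abp leq_addr addKn; apply.
  by rewrite !ltnS -addnA leq_addr.
exists p.+2, G; split=> // t /G0 Gt.
have ltp : (forall x, x \in lspan [set y | y \in tpow V p]%classic -> G t x = 0) ->
    forall x, x \in tpow V p -> G t x = 0.
  by move=> H x xp; apply: H; apply: mem_lspan.
case: t Gt ltp => [|a] /= Gt ltp; first by left; apply: ltp.
case: ifP Gt => [ap|_] Gt; last by left; apply: ltp.
by right; exists a, (p - (a + N))%N; rewrite subnKC.
Qed.

Lemma tlift_decompose (M : lmodType k) m (F : nat -> seq V -> M) (H : seq V -> M)
    (FM : forall t, multilinear (F t)) (HM : multilinear H) :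
  (forall s, H s = \sum_(t < m) F t s) ->
  forall x, tlift HM x = \sum_(t < m) tlift (FM t) x.
Proof.
move=> HE x.
have L0 : linear (fun x => \sum_(t < m) tlift (FM t) x).
  move=> c u v; rewrite scaler_sumr -big_split /=.
  by apply: eq_bigr => t _; exact: (linmapP (tlift (FM t))).
rewrite (tlift_unique HM (h := mklin L0)) // => s /=.
by rewrite HE; apply: eq_bigr => t _; exact: tliftE.
Qed.

(** An element of W_(i + j) lies in V^a R V^(b + j) whenever a + N + b = i, which
    is V^a R V^b (x) V^j, and a product with first factor vanishing on V^a R V^b
    vanishes there. Since z is a sum of such maps, this shows in effect that
    W_(i + j) is contained in W_i (x) V^j. *)
Lemma tlift_split0l (z : linmap T L1) (g : seq V -> L2) (gM : multilinear g)
    (hM : multilinear (split_at i B (z \o word) g)) :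
  (forall x, x \in Wsub R i -> z x = 0) ->
  forall x, x \in Wsub R (i + j) -> tlift hM x = 0.
Proof.
move=> /W_decompose[m [G [zG G0]]] x /WsubP[xV xR].
have FM t : multilinear (split_at i B (G t \o word) g).
  by apply: multilinear_split => //; exact: linmap_word_multilinear.
rewrite (tlift_decompose (m := m) FM) => [|s]; last first.
  rewrite /split_at /= zG; have BL := B_linl (g (drop i s)).
  by rewrite (big_morph (B^~ (g (drop i s))) (linear_funD BL) (linear_fun0 BL)).
rewrite big1 // => t _; have [Gt|[a [b [abi Gt]]]] := G0 t (ltn_ord t).
  refine (tpow_ind (linmapP (tlift (FM t))) (fun s si => _) xV).
  rewrite tliftE /split_at /= Gt ?(linear_fun0 (B_linl _)) //.
  exact: word_take_tpow si.
have {xR} := xR a (b + j)%N; rewrite addnA abi => /(_ erefl).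
apply: lspan_ker => _ [u [r [v [ua rR vb ->]]]].
have vL : linear (fun v => tlift (FM t) (u * r * v)).
  by move=> c y y'; rewrite mulrDr -scalerAr linmapP.
refine (tpow_ind vL (fun s sb => _) vb).
rewrite -(cat_take_drop b s) word_cat mulrA.
have wb := word_take_tpow sb.
have urV : u * r * word (take b s) \in tpow V i.
  by rewrite -abi !tpowM ?(rels_tpow rR).
rewrite (tlift_split (linmap_word_multilinear (G t)) gM (FM t) B_linl B_linr _ urV).
rewrite tlift_word Gt ?(linear_fun0 (B_linl _)) //.
by apply: mem_lspan; exists u, r, (word (take b s)).
Qed.

(** In the same way, W_(i + j) is contained in V^i (x) W_j. *)
Lemma tlift_split0r (z : linmap T L2) (f : seq V -> L1) (fM : multilinear f)
    (hM : multilinear (split_at i B f (z \o word))) :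
  (forall x, x \in Wsub R j -> z x = 0) ->
  forall x, x \in Wsub R (i + j) -> tlift hM x = 0.
Proof.
move=> /W_decompose[m [G [zG G0]]] x /WsubP[xV xR].
have FM t : multilinear (split_at i B f (G t \o word)).
  by apply: multilinear_split => //; exact: linmap_word_multilinear.
rewrite (tlift_decompose (m := m) FM) => [|s]; last first.
  rewrite /split_at /= zG; have BL := B_linr (f (take i s)).
  by rewrite (big_morph (B (f (take i s))) (linear_funD BL) (linear_fun0 BL)).
rewrite big1 // => t _; have [Gt|[a [b [abj Gt]]]] := G0 t (ltn_ord t).
  refine (tpow_ind (linmapP (tlift (FM t))) (fun s si => _) xV).
  rewrite tliftE /split_at /= Gt ?(linear_fun0 (B_linr _)) //.
  exact: word_drop_tpow si.
have {xR} := xR (i + a)%N b; rewrite -!addnA (addnA a) abj => /(_ erefl).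
apply: lspan_ker => _ [u [r [v [ua rR vb ->]]]].
have uL : linear (fun u => tlift (FM t) (u * r * v)).
  by move=> c y y'; rewrite !mulrDl -!scalerAl linmapP.
refine (tpow_ind uL (fun s sa => _) ua).
rewrite -(cat_take_drop i s) word_cat -!mulrA.
have wa := word_drop_tpow sa; have wi := word_take_tpow sa.
rewrite (tlift_split fM (linmap_word_multilinear (G t)) (FM t) B_linl B_linr _ wi).
rewrite tlift_word Gt ?(linear_fun0 (B_linr _)) //.
by apply: mem_lspan; exists (word (drop i s)), r, v; split; rewrite ?mulrA.
Qed.

End Vanishing.
End WordSubspaces.

(** * Agreement on W_p *)

Section Agreement.
Variables (k : fieldType) (V : lmodType k) (N : nat) (R : relspace V N).

(** Quantifying over the proofs of multilinearity keeps them out of the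
    statements about agreement. *)
Definition agreeW (L : lmodType k) (p : nat) (F G : seq V -> L) : Prop :=
  forall (FM : multilinear F) (GM : multilinear G) x,
    x \in Wsub R p -> tlift FM x = tlift GM x.

Lemma multilinearP (L : lmodType k) c (F G : seq V -> L) :
  multilinear F -> multilinear G -> multilinear (c *: F + G).
Proof.
move=> FM GM d s u v t.
have E r : (c *: F + G) r = c *: F r + G r by [].
by rewrite !E FM GM !scalerDr !scalerA [c * d]mulrC addrACA.
Qed.

Lemma multilinear0 (L : lmodType k) : multilinear (0 : seq V -> L).
Proof. by move=> c s u v t; rewrite /= scaler0 addr0. Qed.

Lemma multilinearB (L : lmodType k) (F G : seq V -> L) :
  multilinear F -> multilinear G -> multilinear (F - G).
Proof. exact: multilinear_sub. Qed.

Lemma tlift_irr (L : lmodType k) (F : seq V -> L) (FM FM' : multilinear F) x :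
  tlift FM x = tlift FM' x.
Proof. by congr (tlift _ x); exact: Prop_irrelevance. Qed.

Lemma agreeW_refl (L : lmodType k) p (F : seq V -> L) : agreeW p F F.
Proof. by move=> FM FM' x _; exact: tlift_irr. Qed.

Lemma agreeW_sym (L : lmodType k) p (F G : seq V -> L) : agreeW p F G -> agreeW p G F.
Proof. by move=> FG GM FM x xW; rewrite -(FG FM GM x xW). Qed.

Lemma agreeW_trans (L : lmodType k) p (F G H : seq V -> L) : multilinear G ->
  agreeW p F G -> agreeW p G H -> agreeW p F H.
Proof. by move=> GM FG GH FM HM x xW; rewrite (FG FM GM x xW); exact: GH. Qed.

Lemma agreeW_word (L : lmodType k) p (F G : seq V -> L) :
  (forall s, size s = p -> F s = G s) -> agreeW p F G.
Proof.
move=> FG FM GM x /WsubP[xV _]; apply/eqP; rewrite -subr_eq0; apply/eqP.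
have dL : linear (fun x => tlift FM x - tlift GM x).
  by move=> c u v; rewrite !linmapP scalerBr opprD addrACA.
by refine (tpow_ind dL (fun s sp => _) xV); rewrite !tliftE FG // subrr.
Qed.

Lemma agreeW_linear (L : lmodType k) p c (F F' G G' : seq V -> L) :
  multilinear F -> multilinear F' -> multilinear G -> multilinear G' ->
  agreeW p F F' -> agreeW p G G' -> agreeW p (c *: F + G) (c *: F' + G').
Proof.
move=> FM FM' GM GM' FF GG HM HM' x xW.
rewrite (tlift_linear FM GM HM (c := c)) // (tlift_linear FM' GM' HM' (c := c)) //.
by rewrite (FF FM FM' x xW) (GG GM GM' x xW).
Qed.

(** F G - F' G' is (F - F') G + F' (G - G'), and both summands vanish on W_(i + j)
    by [tlift_split0l] and [tlift_split0r]. *)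
Lemma agreeW_split (L1 L2 L : lmodType k) (B : L1 -> L2 -> L) i j F F' G G' :
  (forall y, linear (B^~ y)) -> (forall x, linear (B x)) ->
  multilinear F -> multilinear F' -> multilinear G -> multilinear G' ->
  agreeW i F F' -> agreeW j G G' ->
  agreeW (i + j) (split_at i B F G) (split_at i B F' G').
Proof.
move=> Bl Br FM FM' GM GM' FF GG.
have HM := multilinear_split i Bl Br FM' GM.
apply: (agreeW_trans HM) => HM1 HM2 x xW; apply/eqP; rewrite -subr_eq0; apply/eqP.
- have FB := multilinearB FM FM'.
  have zE : F - F' = tlift FB \o @word k V by apply/funext => s; apply: esym; exact: tliftE.
  have hM : multilinear (split_at i B (tlift FB \o @word k V) G).
    by rewrite -zE; exact: multilinear_split.
  rewrite -[RHS](tlift_split0l Bl Br GM hM _ xW) => [|y yW].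
    rewrite -scaleN1r addrC -(tlift_linear HM2 HM1 hM (c := -1)) // => s.
    rewrite -zE /split_at scaleN1r [RHS]addrC.
    exact: (linear_funB (Bl _)).
  have E s : (F - F') s = -1 *: F' s + F s by rewrite scaleN1r addrC.
  by rewrite (tlift_linear FM' FM FB E) scaleN1r addrC (FF FM FM') // subrr.
- have GB := multilinearB GM GM'.
  have zE : G - G' = tlift GB \o @word k V by apply/funext => s; apply: esym; exact: tliftE.
  have hM : multilinear (split_at i B F' (tlift GB \o @word k V)).
    by rewrite -zE; exact: multilinear_split.
  rewrite -[RHS](tlift_split0r Bl Br FM' hM _ xW) => [|y yW].
    rewrite -scaleN1r addrC -(tlift_linear HM2 HM1 hM (c := -1)) // => s.
    rewrite -zE /split_at scaleN1r [RHS]addrC.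
    exact: (linear_funB (Br _)).
  have E s : (G - G') s = -1 *: G' s + G s by rewrite scaleN1r addrC.
  by rewrite (tlift_linear GM' GM GB E) scaleN1r addrC (GG GM GM') // subrr.
Qed.

End Agreement.

Section RightLinear.
Variables (k : fieldType) (V : lmodType k) (n : nat).
Hypothesis hN : (2 <= n.+2)%N.
Variable R : relspace V n.+2.
Local Notation A := (homog_alg hN R).
Local Notation w := (wordA hN R).
Implicit Types P Q S M : bimodule A.

Lemma wordA_nil : w [::] = 1.
Proof. by rewrite /wordA /word big_nil. Qed.

Lemma wordA_cat s t : w (s ++ t) = w s * w t.
Proof. by rewrite /wordA word_cat; exact: aprojM. Qed.

(** Equality of the right linear maps on W_p (x) A defined by F and F'. It is a
    partial equivalence relation, reflexive on multilinear right linear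
    functions, and a congruence for all the operations on functions on words. *)
Record eqW M p (F F' : seq V -> M) : Prop := EqW {
  eqW_mult : multilinear F;
  eqW_mult' : multilinear F';
  eqW_right_linear : right_linear w p F;
  eqW_right_linear' : right_linear w p F';
  eqW_agree : agreeW R p F F'
}.

Lemma eqW_refl M p (F : seq V -> M) : multilinear F -> right_linear w p F -> eqW p F F.
Proof. by split=> //; exact: agreeW_refl. Qed.

Lemma eqW_sym M p (F F' : seq V -> M) : eqW p F F' -> eqW p F' F.
Proof. by case=> ? ? ? ? ?; split=> //; exact: agreeW_sym. Qed.

Lemma eqW_trans M p (F G H : seq V -> M) : eqW p F G -> eqW p G H -> eqW p F H.
Proof.
by move=> [FM GM Fp Gp FG] [_ HM _ Hp GH]; split=> //; exact: agreeW_trans GH.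
Qed.

Lemma eqW_linear M p c (F F' G G' : seq V -> M) :
  eqW p F F' -> eqW p G G' -> eqW p (c *: F + G) (c *: F' + G').
Proof.
move=> [FM FM' Fp Fp' FF] [GM GM' Gp Gp' GG].
have rl (K L : seq V -> M) : right_linear w p K -> right_linear w p L ->
    right_linear w p (c *: K + L).
  move=> Kp Lp s; have E r : (c *: K + L) r = c *: K r + L r by [].
  by rewrite !E ract_linl -Kp -Lp.
split; [exact: multilinearP|exact: multilinearP|exact: rl|exact: rl|].
exact: agreeW_linear.
Qed.

Lemma eqW0 M p : eqW p (0 : seq V -> M) 0.
Proof.
apply: eqW_refl; first exact: multilinear0.
by move=> s; have /linear_fun0 -> := @ract_linl _ _ M (w (drop p s)).
Qed.

Lemma eqWD M p (F F' G G' : seq V -> M) :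
  eqW p F F' -> eqW p G G' -> eqW p (F + G) (F' + G').
Proof. by move=> /(eqW_linear 1) FF /FF; rewrite !scale1r. Qed.

Lemma eqWZ M p c (F F' : seq V -> M) : eqW p F F' -> eqW p (c *: F) (c *: F').
Proof. by move=> /(eqW_linear c)/(_ (eqW0 M p)); rewrite !addr0. Qed.

Lemma eqWN M p (F F' : seq V -> M) : eqW p F F' -> eqW p (- F) (- F').
Proof. by move=> /(eqWZ (-1)); rewrite !scaleN1r. Qed.

Lemma eqWB M p (F F' G G' : seq V -> M) :
  eqW p F F' -> eqW p G G' -> eqW p (F - G) (F' - G').
Proof. by move=> FF /eqWN; exact: eqWD. Qed.

Lemma eqW_csum M p m (h h' : nat -> nat -> seq V -> M) :
  (forall i j, (i + j)%N = m -> eqW p (h i j) (h' i j)) ->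
  eqW p (csum m h) (csum m h').
Proof.
move=> hh; apply: (big_ind2 (eqW p)); first exact: eqW0.
  by move=> F F' G G'; exact: eqWD.
by move=> i _; apply: hh; rewrite subnKC // -ltnS.
Qed.

Lemma eqW_csum3 M p m (h h' : nat -> nat -> nat -> seq V -> M) :
  (forall i l j, (i + (l + j))%N = m -> eqW p (h i l j) (h' i l j)) ->
  eqW p (csum3 m h) (csum3 m h').
Proof.
move=> hh; apply: eqW_csum => i r ir; apply: eqW_csum => l j lj.
by apply: hh; rewrite lj.
Qed.

Lemma eqW_csum4 M p m (h h' : nat -> nat -> nat -> nat -> seq V -> M) :
  (forall a b c d, (a + (b + (c + d))).+1 = m ->
     eqW p (h a b c d) (h' a b c d)) ->
  eqW p (csum4 m h) (csum4 m h').
Proof.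
case: m => [_|m hh]; first exact: eqW0.
apply: eqW_csum => a r ar; apply: eqW_csum3 => b c d bcd.
by apply: hh; rewrite bcd ar.
Qed.

Lemma eqW_prodw P Q S (mu : pairing P Q S) p q F F' G G' :
  eqW p F F' -> eqW q G G' ->
  eqW (p + q) (prodw mu p F G) (prodw mu p F' G').
Proof.
move=> [FM FM' Fp Fp' FF] [GM GM' Gp Gp' GG].
have muM := multilinear_split p (pair_linl mu) (pair_linr mu).
split; [exact: muM|exact: muM|exact: right_linear_prodw|exact: right_linear_prodw|].
exact: agreeW_split (pair_linl mu) (pair_linr mu) _ _ _ _ FF GG.
Qed.

Lemma eqW_lmulw M i p (F F' : seq V -> M) :
  eqW p F F' -> eqW (i + p) (lmulw w i F) (lmulw w i F').
Proof.
move=> [FM FM' Fp Fp' FF]; have wM := wordA_multilinear hN R.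
have lM := multilinear_split i (@lact_linl _ _ M) (@lact_linr _ _ M) wM.
split; [exact: lM|exact: lM|exact: right_linear_lmulw|exact: right_linear_lmulw|].
by apply: agreeW_split (@lact_linl _ _ M) (@lact_linr _ _ M) _ _ _ _ _ FF => //;
  exact: agreeW_refl.
Qed.

(** F is F e^j, by right linearity, and W_(p + j) is contained in W_p (x) V^j. *)
Lemma eqW_widen M p j (F F' : seq V -> M) : eqW p F F' -> eqW (p + j) F F'.
Proof.
move=> [FM FM' Fp Fp' FF]; have wM := wordA_multilinear hN R.
split=> //; try exact: right_linear_widen wordA_cat _ _ _ _ _.
have E (G : seq V -> M) : right_linear w p G -> G = split_at p (@ract _ _ M) G w.
  by move=> Gp; apply/funext => s; rewrite {1}Gp.
rewrite (E F Fp) (E F' Fp').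
by apply: agreeW_split (@ract_linl _ _ M) (@ract_linr _ _ M) _ _ _ _ FF _ => //;
  exact: agreeW_refl.
Qed.

Lemma eqW_diffw M o p (F F' : seq V -> M) : eqW p F F' ->
  eqW (p + dstep n o) (diffw w n o F) (diffw w n o F').
Proof.
move=> FF; case: o; rewrite /diffw /dstep.
  apply: eqW_csum => i j ij.
  have -> : (p + n.+1 = i + p + j)%N by rewrite -ij addnCA addnA.
  by apply: eqW_widen; exact: eqW_lmulw.
apply: eqWB; first exact: eqW_widen.
by rewrite addnC; exact: eqW_lmulw.
Qed.

Lemma eqW_cupw P Q S (mu : pairing P Q S) o1 o2 p q F F' G G' :
  eqW p F F' -> eqW q G G' ->
  eqW (cup_width n o1 o2 p q) (cupw w n mu o1 o2 p F G) (cupw w n mu o1 o2 p F' G').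
Proof.
move=> FF GG; rewrite /cupw /cup_width.
case: (o1 && o2); last by rewrite addn0; exact: eqW_prodw.
apply: eqWN; apply: eqW_csum3 => i l j ilj.
have -> : (p + q + n = i + (p + (l + q)) + j)%N.
  by rewrite -ilj [in RHS](addnCA p) addnCA (addnCA (p + q)%N) !addnA.
apply: eqW_widen; apply: eqW_lmulw; apply: eqW_prodw => //.
exact: eqW_lmulw.
Qed.

Lemma eqW_assoc_homotopy P1 P2 P3 P23 S (mu : pairing P1 P23 S) (mu23 : pairing P2 P3 P23)
    o1 o2 o3 p q r d F F' G G' H H' :
  ([&& o1, o2 & o3] -> d.+1 = (p + q + r + n)%N) ->
  eqW p F F' -> eqW q G G' -> eqW r H H' ->
  eqW d (assoc_homotopy w n mu mu23 o1 o2 o3 p q F G H)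
    (assoc_homotopy w n mu mu23 o1 o2 o3 p q F' G' H').
Proof.
move=> dE FF GG HH; rewrite /assoc_homotopy.
case: [&& _, _ & _] dE => [/(_ isT) dE|_]; last exact: eqW0.
apply: eqW_csum4 => a b c e abce.
have -> : (d = a + (p + (b + (q + (c + r)))) + e)%N by move: dE abce; clear; lia.
apply: eqW_widen; apply: eqW_lmulw; apply: eqW_prodw => //.
apply: eqW_lmulw; apply: eqW_prodw => //; exact: eqW_lmulw.
Qed.

Lemma nuS p : nu n.+2 p.+1 = (nu n.+2 p + dstep n (odd p))%N.
Proof.
rewrite /nu /dstep /= uphalf_half; case: (odd p) => /=.
  by rewrite mulnDr muln1 addn0 addnC -addnA.
by rewrite add0n addn0.
Qed.

Lemma nuD p q :
  nu n.+2 (p + q) = cup_width n (odd p) (odd q) (nu n.+2 p) (nu n.+2 q).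
Proof.
rewrite /nu /cup_width halfD oddD !mulnDr.
by case: (odd p); case: (odd q) => /=; clear; lia.
Qed.

(** * Koszul cochains as functions on words *)

Section Cochains.
Variable M : bimodule A.

(** The right linear function representing a cochain. It depends on the chosen
    values of the cochain outside of W_(nu p), but its class under [eqW] does
    not. *)
Definition rext p (f : cochain R p M) : seq V -> M :=
  split_at (nu n.+2 p) (@ract _ _ M) (eval_word f) w.

Lemma rext_word p (f : cochain R p M) s :
  size s = nu n.+2 p -> rext f s = eval_word f s.
Proof.
by move=> sp; rewrite /rext /split_at take_oversize ?drop_oversize ?sp // wordA_nil ract1.
Qed.

Lemma rext_refl p (f : cochain R p M) : eqW (nu n.+2 p) (rext f) (rext f).
Proof.
apply: eqW_refl.
  exact: multilinear_split (@ract_linl _ _ M) (@ract_linr _ _ M)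
    (eval_word_multilinear f) (wordA_multilinear hN R).
move=> s; rewrite /rext /split_at take_takel //.
have -> : drop (nu n.+2 p) (take (nu n.+2 p) s) = [::].
  by rewrite drop_oversize // size_take_min geq_minl.
by rewrite wordA_nil ract1.
Qed.

Lemma rext_linear p c (f g : cochain R p M) : rext (c *: f + g) = c *: rext f + rext g.
Proof. by apply/funext => s; rewrite /rext /split_at eval_wordP ract_linl. Qed.

Lemma rext0 p : rext (0 : cochain R p M) = 0.
Proof.
by have := rext_linear (-1) (0 : cochain R p M) 0;
  rewrite scaler0 addr0 scaleN1r addNr.
Qed.

Lemma W_valP p (x : W R p) : val x \in Wsub R p.
Proof. by case: x. Qed.

Lemma tlift_rext p (f : cochain R p M) (fM : multilinear (rext f)) (x : W R (nu n.+2 p)) :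
  tlift fM (val x) = f x.
Proof.
rewrite -(tlift_eval_word f x).
exact: (agreeW_word (R := R) (@rext_word p f) _ _ (W_valP x)).
Qed.

(** The way in which operations on cochains are recognized: it is enough to
    compare values on W_(nu p). *)
Lemma rextP p (f : cochain R p M) (F : seq V -> M) (FM : multilinear F) :
  right_linear w (nu n.+2 p) F -> (forall x, f x = tlift FM (val x)) ->
  eqW (nu n.+2 p) (rext f) F.
Proof.
move=> Fp fF; have [fM _ fp _ _] := rext_refl f.
split=> // fM' FM' x xW; rewrite -[x]/(val (Subm xW)) tlift_rext fF.
exact: tlift_irr.
Qed.

Lemma rext_inj p (f g : cochain R p M) :
  eqW (nu n.+2 p) (rext f) (rext g) -> f = g.
Proof.
move=> [fM gM _ _ fg]; apply/val_inj/funext => x /=.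
by rewrite -(tlift_rext fM) -(tlift_rext gM) (fg fM gM) // W_valP.
Qed.

(** On words of length nu (p + 1) the formula for b_K is [diffw] term by term. *)
Lemma rext_bK p (f : cochain R p M) :
  eqW (nu n.+2 p.+1) (rext (bK f)) (diffw w n (odd p) (rext f)).
Proof.
have /eqW_diffw-/(_ (odd p)) := rext_refl f; rewrite -nuS => -[DM _ Dp _ _].
apply: (rextP (FM := DM)) => // x.
rewrite -[LHS]/(tlift (bK_word_multilinear f) (val x)).
have xW := W_valP x.
refine (agreeW_word _ _ _ xW) => s; rewrite nuS /bK_word /diffw /dstep.
case: (odd p) => sp; last first.
  have E (F G : seq V -> M) t : (F - G) t = F t - G t by [].
  rewrite E; congr (_ - _).
  by rewrite /lmulw /split_at -rext_word // size_drop sp addnK.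
have eL : linear (fun F : seq V -> M => F s) by [].
by rewrite (linear_csum eL).
Qed.

End Cochains.

(** In the given formula for odd degrees the segment of length l between the two
    factors acts on f; moving it to g gives [cupw]. *)
Lemma rext_cup P Q S (mu : pairing P Q S) p q (f : cochain R p P) (g : cochain R q Q) :
  eqW (nu n.+2 (p + q)) (rext (cup_via mu f g))
    (cupw w n mu (odd p) (odd q) (nu n.+2 p) (rext f) (rext g)).
Proof.
have := eqW_cupw mu (odd p) (odd q) (rext_refl f) (rext_refl g).
rewrite -nuD => -[CM _ Cp _ _]; apply: (rextP (FM := CM)) => // x.
have xW := W_valP x.
have mM := multilinear_comp mu (cup_word_multilinear f g).
have mL := linear_comp_fun (linmapP mu) (linmapP (tlift (cup_word_multilinear f g))).
transitivity (tlift mM (val x)).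
  rewrite (tlift_unique mM (h := mklin mL)) // => s.
  rewrite -[LHS]/(mu (tlift (cup_word_multilinear f g) (word s))).
  by rewrite tliftE.
refine (agreeW_word _ _ _ xW) => s; rewrite nuD /cup_width /cupw /= /cup_word.
have [_ _ fp _ _] := rext_refl f.
have muD := linear_funD (linmapP mu); have mu0 := linear_fun0 (linmapP mu).
case: (odd p && odd q) => sn; last first.
  rewrite addn0 in sn.
  rewrite /prodw /split_at /pair_op rext_word ?rext_word //.
    by rewrite size_drop sn addKn.
  by rewrite size_takel // sn leq_addr.
rewrite (linear_funN (linmapP mu)).
have E (F : seq V -> S) t : (- F) t = - F t by [].
rewrite E; congr (- _); rewrite csum3C23.
have eL : linear (fun F : seq V -> S => F s) by [].
rewrite /csum3 (linear_csum eL) (big_morph mu muD mu0); apply: eq_bigr => i _.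
rewrite (linear_csum eL) (big_morph mu muD mu0) /csum.
have ni : ((n - i).+1 <= n.+1)%N by rewrite ltnS leq_subr.
rewrite [RHS](big_ord_widen _ (fun j =>
  lmulw w i (prodw mu (nu n.+2 p) (rext f) (lmulw w (n - i - j) (rext g))) s) ni).
apply: eq_big => [j|j ij].
  by rewrite !subSS subn0 ltnS leq_subRL // -ltnS.
rewrite -prodw_widen // lmulw_prodw addnA.
by rewrite subSS subSS subn0.
Qed.

End RightLinear.

(** * The cup product on Koszul cohomology *)

Section CohomologyProducts.
Variables (k : fieldType) (V : lmodType k) (n : nat).
Hypothesis hN : (2 <= n.+2)%N.
Variable R : relspace V n.+2.
Local Notation A := (homog_alg hN R).
Local Notation w := (wordA hN R).
Local Notation nu := (nu n.+2).
Local Notation D o := (diffw w n o).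
Implicit Types P Q S M : bimodule A.

Let wN := wordA_nil hN R.
Let wC := wordA_cat hN R.

Lemma cup_width_stepl o1 o2 p q :
  (cup_width n o1 o2 p q + dstep n (o1 (+) o2))%N =
  cup_width n (~~ o1) o2 (p + dstep n o1) q.
Proof. by rewrite /cup_width /dstep; case: o1; case: o2 => /=; clear; lia. Qed.

Lemma cup_width_stepr o1 o2 p q :
  (cup_width n o1 o2 p q + dstep n (o1 (+) o2))%N =
  cup_width n o1 (~~ o2) p (q + dstep n o2).
Proof. by rewrite /cup_width /dstep; case: o1; case: o2 => /=; clear; lia. Qed.

Definition closedw M p (F : seq V -> M) : Prop :=
  eqW (nu p) F F /\ eqW (nu p.+1) (D (odd p) F) 0.

Lemma rext_cocycle M p (z : cocycle M p) : closedw p (rext (val z)).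
Proof.
split; first exact: rext_refl.
have zb : bK (val z) = 0 by case: z => z /= /eqP.
by apply: eqW_trans (eqW_sym (rext_bK (val z))) _; rewrite zb rext0; exact: eqW0.
Qed.

Lemma closedw_cocycle M p (f : cochain R p M) (F : seq V -> M) :
  eqW (nu p) (rext f) F -> closedw p F -> f \in @cocycles _ _ _ hN R M p.
Proof.
move=> fF [_ F0]; apply/eqP; apply: rext_inj.
apply: eqW_trans (rext_bK f) _.
have /eqW_diffw-/(_ (odd p)) := fF; rewrite -nuS => DF.
by apply: eqW_trans DF _; rewrite rext0.
Qed.

Section Cup.
Variables (P Q S : bimodule A) (mu : pairing P Q S) (p q : nat).
Local Notation cupF := (cupw w n mu).

Lemma closedw_cup F G : closedw p F -> closedw q G ->
  closedw (p + q) (cupF (odd p) (odd q) (nu p) F G).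
Proof.
move=> [FF F0] [GG G0]; split; first by rewrite nuD; exact: eqW_cupw.
rewrite nuS nuD oddD (diffw_cupw wN wC); last exact: eqW_right_linear FF.
rewrite -[X in eqW _ _ X]addr0; apply: eqWD.
  rewrite cup_width_stepl -nuS -(cupw0l w n mu (~~ odd p) (odd q) (nu p.+1) G).
  exact: eqW_cupw.
rewrite cup_width_stepr -[X in eqW _ _ X](scaler0 _ ((-1) ^+ odd p)).
apply: eqWZ; rewrite -nuS -(cupw0r w n mu (odd p) (~~ odd q) (nu p) F).
exact: eqW_cupw.
Qed.

Lemma cup_via_cocycle (f : cocycle P p) (g : cocycle Q q) :
  cup_via mu (val f) (val g) \in @cocycles _ _ _ hN R S (p + q).
Proof.
apply: closedw_cocycle (rext_cup mu (val f) (val g)) _.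
by apply: closedw_cup; exact: rext_cocycle.
Qed.

Definition cup_cocycle (f : cocycle P p) (g : cocycle Q q) : cocycle S (p + q) :=
  Subm (cup_via_cocycle f g).

Lemma rext_cup_cocycle f g :
  eqW (nu (p + q)) (rext (val (cup_cocycle f g)))
    (cupF (odd p) (odd q) (nu p) (rext (val f)) (rext (val g))).
Proof. exact: rext_cup. Qed.

End Cup.

(** Equality in cohomology for representing functions. Stating it for functions
    instead of cochains avoids comparing the types of cochains of degrees such as
    p + (q + r) and p + q + r. *)
Definition cohom M p (F F' : seq V -> M) : Prop :=
  eqW (nu p) F F' \/
  exists m U, [/\ p = m.+1, eqW (nu m) U U & eqW (nu p) F (F' + D (odd m) U)].

Lemma cohom_eqW M p (F F' G G' : seq V -> M) :
  eqW (nu p) F G -> eqW (nu p) F' G' -> cohom p G G' -> cohom p F F'.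
Proof.
move=> FG FG' [GG|[m [U [pm UU GG]]]]; [left|right].
  by apply: eqW_trans FG _; apply: eqW_trans GG _; exact: eqW_sym.
exists m, U; split=> //; apply: eqW_trans FG _; apply: eqW_trans GG _.
apply: eqWD; first exact: eqW_sym.
by rewrite pm nuS; exact: eqW_diffw.
Qed.

Lemma HK_class_linear M p c (z z' : cocycle M p) :
  HK_class (c *: z + z') = c *: HK_class z + HK_class z'.
Proof. exact: lproj_linear. Qed.

Lemma HK_classP M p (x : HK M p) : exists z : cocycle M p, x = HK_class z.
Proof. by exists (lrepr x); rewrite /HK_class lreprK. Qed.

Lemma HK_class_eqP M p (z z' : cocycle M p) :
  HK_class z = HK_class z' <-> cohom p (rext (val z)) (rext (val z')).
Proof.
have E : HK_class z = HK_class z' <-> z - z' \in @coboundaries _ _ _ _ _ M p.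
  by rewrite -lprojE; split=> [/eqP|/eqP].
rewrite E.
have refl (y y' : cocycle M p) : eqW (nu p) (rext (val y)) (rext (val y')) -> y = y'.
  by move=> /rext_inj yy; apply: val_inj.
split; last first.
  case=> [/refl ->|]; first by rewrite subrr rpred0.
  move=> [m [U [pm UU zz]]]; subst p; apply/asboolP.
  pose u : cochain R m M := onW R (nu m) (eqW_mult UU); exists u.
  have uU : eqW (nu m) (rext u) U.
    by apply: (rextP (FM := eqW_mult UU)) (eqW_right_linear UU) _.
  apply: rext_inj; apply: eqW_sym; apply: eqW_trans (rext_bK u) _.
  have -> : val (z - z') = -1 *: val z' + val z by rewrite scaleN1r addrC.
  rewrite rext_linear scaleN1r addrC.
  have -> : D (odd m) (rext u) = rext (val z') + D (odd m) (rext u) - rext (val z').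
    by rewrite addrAC subrr add0r.
  apply: eqWB; last exact: rext_refl.
  apply: eqW_sym; apply: eqW_trans zz _; apply: eqWD; first exact: rext_refl.
  by rewrite nuS; apply: eqW_diffw; exact: eqW_sym.
case: p z z' {E refl} => [|m] z z'.
  by rewrite [_ \in _]subr_eq0 => /eqP ->; left; exact: rext_refl.
move=> /asboolP[h hE]; right; exists m, (rext h); split=> //; first exact: rext_refl.
have -> : val z = bK h + val z' by rewrite -hE /= subrK.
rewrite -(scale1r (bK h)) rext_linear scale1r addrC; apply: eqWD; first exact: rext_refl.
exact: rext_bK.
Qed.

(** If G is a cocycle, the Leibniz rule shows that (D U) G is the differential of
    U G. *)
Lemma cohom_cupl P Q S (mu : pairing P Q S) p q F F' G :
  cohom p F F' -> closedw q G ->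
  cohom (p + q) (cupw w n mu (odd p) (odd q) (nu p) F G)
                (cupw w n mu (odd p) (odd q) (nu p) F' G).
Proof.
move=> [FF|[m [U [-> UU FF]]]] [GG G0].
  by left; rewrite nuD; exact: eqW_cupw.
right; exists (m + q)%N, (cupw w n mu (odd m) (odd q) (nu m) U G).
split=> //; first by rewrite nuD; exact: eqW_cupw.
have F'F' : eqW (nu m.+1) F' F'.
  have -> : F' = (F' + D (odd m) U) - D (odd m) U by rewrite addrK.
  apply: eqWB; first exact: eqW_trans (eqW_sym FF) FF.
  by rewrite nuS; exact: eqW_diffw.
rewrite nuD; apply: eqW_trans (eqW_cupw mu (odd m.+1) (odd q) FF GG) _.
rewrite (linear_funD (cupw_linl w n mu _ _ _ G)).
apply: eqWD; first exact: eqW_cupw.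
rewrite oddD (diffw_cupw wN wC); last exact: eqW_right_linear UU.
rewrite -[X in eqW _ X]addr0 -nuS; apply: eqWD.
  by apply: eqW_cupw => //; rewrite nuS; exact: eqW_diffw.
rewrite -nuD addSn nuS nuD oddD cup_width_stepr.
apply: eqW_sym; rewrite -[X in eqW _ _ X](scaler0 _ ((-1) ^+ odd m)).
apply: eqWZ; rewrite -nuS -(cupw0r w n mu (odd m) (~~ odd q) (nu m) U).
exact: eqW_cupw.
Qed.

(** If F is a cocycle, F (D U) is the differential of F U up to the sign of the
    Leibniz rule, which the primitive has to carry. *)
Lemma cohom_cupr P Q S (mu : pairing P Q S) p q F G G' :
  closedw p F -> cohom q G G' ->
  cohom (p + q) (cupw w n mu (odd p) (odd q) (nu p) F G)
                (cupw w n mu (odd p) (odd q) (nu p) F G').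
Proof.
move=> [FF F0] [GG|[m [U [-> UU GG]]]].
  by left; rewrite nuD; exact: eqW_cupw.
have FU : eqW (nu (p + m)) (cupw w n mu (odd p) (odd m) (nu p) F U)
                            (cupw w n mu (odd p) (odd m) (nu p) F U).
  by rewrite nuD; exact: eqW_cupw.
right; exists (p + m)%N, ((-1) ^+ odd p *: cupw w n mu (odd p) (odd m) (nu p) F U).
split; [by rewrite addnS|exact: eqWZ|].
have G'G' : eqW (nu m.+1) G' G'.
  have -> : G' = (G' + D (odd m) U) - D (odd m) U by rewrite addrK.
  apply: eqWB; first exact: eqW_trans (eqW_sym GG) GG.
  by rewrite nuS; exact: eqW_diffw.
rewrite nuD; apply: eqW_trans (eqW_cupw mu (odd p) (odd m.+1) FF GG) _.
rewrite (linear_funD (cupw_linr w n mu _ _ _ F)).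
apply: eqWD; first exact: eqW_cupw.
rewrite diffwZ oddD (diffw_cupw wN wC); last exact: eqW_right_linear FF.
rewrite scalerDr scalerA -signr_addb addbb expr0 scale1r.
rewrite -[X in eqW _ X]add0r; apply: eqWD; last first.
  by apply: eqW_cupw => //; rewrite nuS; exact: eqW_diffw.
rewrite -nuD addnS nuS nuD oddD cup_width_stepl.
apply: eqW_sym; rewrite -[X in eqW _ _ X](scaler0 _ ((-1) ^+ odd p)).
apply: eqWZ; rewrite -nuS -(cupw0l w n mu (~~ odd p) (odd m) (nu p.+1) U).
exact: eqW_cupw.
Qed.

Lemma gcast_HK_class M p q (e : p = q) (z : cocycle M p) (z' : cocycle M q) :
  cohom q (rext (val z)) (rext (val z')) ->
  gcast (H := HK M) e (HK_class z) = HK_class z'.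
Proof. by case: q / e z' => z' /HK_class_eqP. Qed.

Section Multiplication.
Variables (P Q S : bimodule A) (mu : pairing P Q S).

(** Computed on chosen representatives; [hk_mulE] shows that any other ones give
    the same class. *)
Definition hk_mul p q (x : HK P p) (y : HK Q q) : HK S (p + q) :=
  HK_class (cup_cocycle mu (lrepr x) (lrepr y)).

Lemma hk_mulE p q (f : cocycle P p) (g : cocycle Q q) :
  hk_mul (HK_class f) (HK_class g) = HK_class (cup_cocycle mu f g).
Proof.
rewrite /hk_mul; set f' := lrepr _; set g' := lrepr _.
have ff : HK_class f' = HK_class f by exact: lreprK.
have gg : HK_class g' = HK_class g by exact: lreprK.
transitivity (HK_class (cup_cocycle mu f g')).
  apply/HK_class_eqP; apply: cohom_eqW (rext_cup_cocycle _ _ _) (rext_cup_cocycle _ _ _) _.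
  by apply: cohom_cupl (rext_cocycle _); apply/HK_class_eqP.
apply/HK_class_eqP; apply: cohom_eqW (rext_cup_cocycle _ _ _) (rext_cup_cocycle _ _ _) _.
by apply: cohom_cupr (rext_cocycle _) _; apply/HK_class_eqP.
Qed.

Lemma hk_mul_induced : induced_by_cup mu hk_mul.
Proof. by move=> p q f g; exists (cup_cocycle mu f g) => //; exact: hk_mulE. Qed.

Lemma hk_mul_linl p q (y : HK Q q) : linear (fun x : HK P p => hk_mul x y).
Proof.
move=> c x x'; have [g ->] := HK_classP y.
have [f ->] := HK_classP x; have [f' ->] := HK_classP x'.
rewrite -HK_class_linear !hk_mulE -HK_class_linear; apply/HK_class_eqP; left.
apply: eqW_trans (rext_cup_cocycle _ _ _) _.
have -> : val (c *: f + f') = c *: val f + val f' by [].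
have -> : val (c *: cup_cocycle mu f g + cup_cocycle mu f' g) =
  c *: val (cup_cocycle mu f g) + val (cup_cocycle mu f' g) by [].
rewrite !rext_linear (cupw_linl w n mu _ _ _ _ c).
by apply: eqW_linear; apply: eqW_sym; exact: rext_cup_cocycle.
Qed.

Lemma hk_mul_linr p q (x : HK P p) : linear (@hk_mul p q x).
Proof.
move=> c y y'; have [f ->] := HK_classP x.
have [g ->] := HK_classP y; have [g' ->] := HK_classP y'.
rewrite -HK_class_linear !hk_mulE -HK_class_linear; apply/HK_class_eqP; left.
apply: eqW_trans (rext_cup_cocycle _ _ _) _.
have -> : val (c *: g + g') = c *: val g + val g' by [].
have -> : val (c *: cup_cocycle mu f g + cup_cocycle mu f g') =
  c *: val (cup_cocycle mu f g) + val (cup_cocycle mu f g') by [].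
rewrite !rext_linear (cupw_linr w n mu _ _ _ _ c).
by apply: eqW_linear; apply: eqW_sym; exact: rext_cup_cocycle.
Qed.

End Multiplication.

Section Associativity.
Variables (P1 P2 P3 P12 P23 S : bimodule A).
Variables (mu : pairing P1 P23 S) (mu23 : pairing P2 P3 P23).
Variables (mu' : pairing P12 P3 S) (mu12 : pairing P1 P2 P12).
Hypothesis muA : forall x y z,
  pair_op mu x (pair_op mu23 y z) = pair_op mu' (pair_op mu12 x y) z.

(** In [cupwA] the terms containing a differential vanish on cocycles. There
    remains the differential of the homotopy, which is 0 unless the three degrees
    are odd; then p + q + r - 1 is even and has the degree of the homotopy. *)
Lemma cohom_assoc p q r F G H : closedw p F -> closedw q G -> closedw r H ->
  cohom (p + q + r)
    (cupw w n mu (odd p) (odd (q + r)) (nu p) F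
       (cupw w n mu23 (odd q) (odd r) (nu q) G H))
    (cupw w n mu' (odd (p + q)) (odd r) (nu (p + q))
       (cupw w n mu12 (odd p) (odd q) (nu p) F G) H).
Proof.
move=> [FF F0] [GG G0] [HH H0].
have := cupwA wN wC n muA (odd p) (odd q) (odd r) H
  (eqW_right_linear FF) (eqW_right_linear GG).
rewrite -nuD -!oddD -!nuS.
set X := cupw w n mu _ _ _ _ _; set Y := cupw w n mu' _ _ _ _ _ => XY.
have HX : eqW (nu (p + q + r)) X X.
  by rewrite -addnA nuD; apply: eqW_cupw => //; rewrite nuD; exact: eqW_cupw.
have HY : eqW (nu (p + q + r)) Y Y.
  by rewrite nuD; apply: eqW_cupw => //; rewrite nuD; exact: eqW_cupw.
have nuDD : nu (p + q + r) = (nu p + nu q + nu r + (if odd p && odd q then n else 0)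
    + (if (odd p (+) odd q) && odd r then n else 0))%N.
  by rewrite !nuD oddD /cup_width; clear; lia.
have Z1 : eqW (nu (p + q + r)) (assoc_homotopy w n mu mu23 (~~ odd p) (odd q) (odd r)
    (nu p.+1) (nu q) (D (odd p) F) G H) 0.
  rewrite -(@assoc_homotopy0 _ _ _ w n _ _ _ _ _ mu mu23 (~~ odd p) (odd q) (odd r)
              (nu p.+1) (nu q) 0 G H (Or31 _ _ erefl)).
  refine (eqW_assoc_homotopy mu mu23 _ F0 GG HH); rewrite nuDD nuS /dstep.
  by case: (odd p); case: (odd q); case: (odd r) => //= _; clear; lia.
have Z2 : eqW (nu (p + q + r)) (assoc_homotopy w n mu mu23 (odd p) (~~ odd q) (odd r)
    (nu p) (nu q.+1) F (D (odd q) G) H) 0.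
  rewrite -(@assoc_homotopy0 _ _ _ w n _ _ _ _ _ mu mu23 (odd p) (~~ odd q) (odd r)
              (nu p) (nu q.+1) F 0 H (Or32 _ _ erefl)).
  refine (eqW_assoc_homotopy mu mu23 _ FF G0 HH); rewrite nuDD nuS /dstep.
  by case: (odd p); case: (odd q); case: (odd r) => //= _; clear; lia.
have Z3 : eqW (nu (p + q + r)) (assoc_homotopy w n mu mu23 (odd p) (odd q) (~~ odd r)
    (nu p) (nu q) F G (D (odd r) H)) 0.
  rewrite -(@assoc_homotopy0 _ _ _ w n _ _ _ _ _ mu mu23 (odd p) (odd q) (~~ odd r)
              (nu p) (nu q) F G 0 (Or33 _ _ erefl)).
  refine (eqW_assoc_homotopy mu mu23 _ FF GG H0); rewrite nuDD nuS /dstep.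
  by case: (odd p); case: (odd q); case: (odd r) => //= _; clear; lia.
set Phi := assoc_homotopy _ _ _ _ (odd p) (odd q) (odd r) _ _ _ _ _ in XY.
have XE : eqW (nu (p + q + r)) (D (~~ odd (p + q + r)) Phi) (D (~~ odd (p + q + r)) Phi) ->
    eqW (nu (p + q + r)) X (Y - D (~~ odd (p + q + r)) Phi).
  move=> DPhi; have -> : X = Y + (X - Y) by rewrite addrC subrK.
  apply: eqWD => //; rewrite XY; apply: eqWN.
  have E : D (~~ odd (p + q + r)) Phi + 0 + (-1) ^+ odd p *: (0 : seq V -> S)
      + (-1) ^+ odd (p + q) *: (0 : seq V -> S) = D (~~ odd (p + q + r)) Phi.
    by rewrite !scaler0 !addr0.
  rewrite -[X in eqW _ _ X]E; apply: eqWD; last exact: eqWZ.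
  apply: eqWD; last exact: eqWZ.
  apply: eqWD; [exact: DPhi|exact: Z1].
case ooo: [&& odd p, odd q & odd r]; last first.
  have Phi0 : Phi = 0 by rewrite /Phi /assoc_homotopy ooo.
  left; move: XE; rewrite Phi0 -(scaler0 _ (0 : k)) diffwZ scale0r subr0; apply.
  exact: eqW0.
have [m pqr] : exists m, (p + q + r = m.+1)%N.
  by exists (p + q + r).-1; case: (p) ooo.
have om : odd m = false.
  have : odd (p + q + r) by rewrite !oddD; case/and3P: ooo => -> -> ->.
  by rewrite pqr => /negbTE.
have nm : nu (p + q + r) = (nu m).+1 by rewrite pqr nuS om addn1.
have PhiPhi : eqW (nu m) Phi Phi.
  refine (eqW_assoc_homotopy mu mu23 _ FF GG HH) => _; rewrite -nm nuDD.
  by case/and3P: ooo => -> -> ->; rewrite addn0.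
right; exists m, (- Phi); split=> //; first exact: eqWN.
rewrite -scaleN1r diffwZ scaleN1r.
have -> : odd m = ~~ odd (p + q + r) by rewrite pqr negbK.
by apply: XE; rewrite pqr /= negbK nuS; exact: eqW_diffw.
Qed.

Lemma hk_mulA p q r (x : HK P1 p) (y : HK P2 q) (z : HK P3 r) :
  gcast (H := HK S) (addnA p q r) (hk_mul mu x (hk_mul mu23 y z)) =
  hk_mul mu' (hk_mul mu12 x y) z.
Proof.
have [f ->] := HK_classP x; have [g ->] := HK_classP y; have [h ->] := HK_classP z.
rewrite !hk_mulE; apply: gcast_HK_class.
have fP := rext_cocycle f; have gP := rext_cocycle g; have hP := rext_cocycle h.
apply: cohom_eqW (cohom_assoc fP gP hP).
  apply: eqW_trans; first by rewrite -addnA; exact: rext_cup_cocycle.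
  rewrite -addnA nuD; apply: eqW_cupw; first by case: fP.
  exact: rext_cup_cocycle.
apply: eqW_trans (rext_cup_cocycle _ _ _) _.
rewrite [nu (p + q + r)]nuD; apply: eqW_cupw; last by case: hP.
exact: rext_cup_cocycle.
Qed.

End Associativity.

(** A central element u of a bimodule defines the 0-cochain sending 1 to u, whose
    right linear extension is s |-> u s. It commutes with e because u is
    central. *)
Section Unit.
Variables (U : bimodule A) (u : U).
Hypothesis uC : forall a, lact a u = ract u a.

Definition unitw (s : seq V) : U := ract u (w s).

Lemma unitw_multilinear : multilinear unitw.
Proof.
by move=> c s v v' t; rewrite /unitw (wordA_multilinear hN R c s v v' t) ract_linr.
Qed.

Definition unit_cochain : cochain R 0 U := onW R (nu 0) unitw_multilinear.

Lemma nu0 : nu 0 = 0%N.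
Proof. by rewrite /Defs.nu muln0. Qed.

Lemma unitw_right_linear : right_linear w 0 unitw.
Proof. by move=> s; rewrite /unitw take0 drop0 wN ract1. Qed.

Lemma rext_unit : eqW (nu 0) (rext unit_cochain) unitw.
Proof.
by apply: (rextP (FM := unitw_multilinear)) => //; rewrite nu0; exact: unitw_right_linear.
Qed.

Lemma unitw_closed : closedw 0 unitw.
Proof.
split; first by rewrite nu0; apply: eqW_refl unitw_multilinear unitw_right_linear.
have -> : D (odd 0) unitw = 0; last exact: eqW0.
apply/eqP; rewrite subr_eq0; apply/eqP/funext => s.
by rewrite /lmulw /split_at /unitw -lractA uC -ractA -wC cat_take_drop.
Qed.

Definition unit_cocycle : cocycle U 0 := Subm (closedw_cocycle rext_unit unitw_closed).

Definition hk_one : HK U 0 := HK_class unit_cocycle.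

Lemma hk_mul_1l P (mu : pairing U P P) (u1 : forall x, pair_op mu u x = x) p (x : HK P p) :
  hk_mul mu hk_one x = x.
Proof.
have [f ->] := HK_classP x; rewrite /hk_one hk_mulE; apply/HK_class_eqP; left.
apply: eqW_trans (rext_cup_cocycle mu unit_cocycle f) _.
apply: eqW_trans.
  by rewrite nuD; apply: eqW_cupw; [exact: rext_unit|exact: rext_refl].
rewrite /cupw /= nu0; have -> : prodw mu 0 unitw (rext (val f)) = rext (val f).
  by apply/funext => s; rewrite /prodw /split_at /unitw take0 drop0 wN ract1 u1.
exact: rext_refl.
Qed.

Lemma hk_mul_1r P (mu : pairing P U P) (u1 : forall x, pair_op mu x u = x) p (x : HK P p) :
  gcast (H := HK P) (addn0 p) (hk_mul mu x hk_one) = x.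
Proof.
have [f ->] := HK_classP x; rewrite /hk_one hk_mulE; apply: gcast_HK_class; left.
have cast (F G : seq V -> P) : eqW (nu (p + 0)) F G -> eqW (nu p) F G.
  by rewrite addn0.
apply: cast; apply: eqW_trans (rext_cup_cocycle mu f unit_cocycle) _.
apply: eqW_trans.
  by rewrite nuD; apply: eqW_cupw; [exact: rext_refl|exact: rext_unit].
rewrite /cupw andbF addn0.
have -> : prodw mu (nu p) (rext (val f)) unitw = rext (val f).
  have [_ _ fp _ _] := rext_refl (val f); apply/funext => s.
  rewrite /prodw /split_at /unitw {1}/pair_op pair_ract.
  by rewrite -/(pair_op mu _ _) u1 -fp.
exact: rext_refl.
Qed.

End Unit.

End CohomologyProducts.

Theorem proposition3p6 (k : fieldType) (V : lmodType k) (N : nat)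
    (hN : (2 <= N)%N) (R : relspace V N) :
  let A : algType k := homog_alg hN R in
  let AA : bimodule A := regular_bimodule A in
  let kk : bimodule A := trivial_bimodule hN R in
  exists (mulA : forall p q, HK AA p -> HK AA q -> HK AA (p + q)%N) (oneA : HK AA 0),
    [/\ induced_by_cup (btens_idl AA) mulA,
        graded_algebra mulA oneA,
        exists (mulk : forall p q, HK kk p -> HK kk q -> HK kk (p + q)%N)
               (onek : HK kk 0),
          induced_by_cup (trivial_idk hN R) mulk
          /\ graded_algebra mulk onek
      & forall M : bimodule A,
          exists (lmul : forall p q, HK AA p -> HK M q -> HK M (p + q)%N)
                 (rmul : forall p q, HK M p -> HK AA q -> HK M (p + q)%N),
            [/\ induced_by_cup (btens_idl M) lmul,
                induced_by_cup (btens_idr M) rmul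
              & graded_bimodule mulA oneA lmul rmul]].
Proof.
case: N hN R => [//|[//|n]] hN R A AA kk.
pose muk : pairing kk kk kk := pairing_idk (homog_aug1 hN R) (@homog_augM _ _ _ hN R).
have oneAC (a : A) : lact a (1 : AA) = ract (1 : AA) a by rewrite /= mulr1 mul1r.
have onekC (a : A) : lact a (1 : kk) = ract (1 : kk) a by [].
have idlE (M : bimodule A) a m : pair_op (pairing_idl M) a m = lact a m.
  exact: btens_idlE.
have idrE (M : bimodule A) m a : pair_op (pairing_idr M) m a = ract m a.
  exact: btens_idrE.
have mukE (c d : kk) : pair_op muk c d = (c : k) * (d : k) by exact: btens_idkE.
exists (hk_mul (pairing_idl AA)), (hk_one oneAC); split.
- exact: (hk_mul_induced (pairing_idl AA)).
- split.
  + exact: hk_mul_linl.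
  + exact: hk_mul_linr.
  + by move=> p q r x y z; apply: hk_mulA => a b c; rewrite !idlE /= mulrA.
  + by move=> p x; apply: hk_mul_1l => a; rewrite idlE lact1.
  + by move=> p x; apply: hk_mul_1r => a; rewrite idlE /= mulr1.
- exists (hk_mul muk), (hk_one onekC); split; first exact: (hk_mul_induced muk).
  split.
  + exact: hk_mul_linl.
  + exact: hk_mul_linr.
  + by move=> p q r x y z; apply: hk_mulA => a b c; rewrite !mukE mulrA.
  + by move=> p x; apply: hk_mul_1l => a; rewrite mukE mul1r.
  + by move=> p x; apply: hk_mul_1r => a; rewrite mukE mulr1.
- move=> M; exists (hk_mul (pairing_idl M)), (hk_mul (pairing_idr M)).
  split; [exact: (hk_mul_induced (pairing_idl M))| |split].
    exact: (hk_mul_induced (pairing_idr M)).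
  + exact: hk_mul_linl.
  + exact: hk_mul_linr.
  + exact: hk_mul_linl.
  + exact: hk_mul_linr.
  + by move=> p q r x y z; apply: hk_mulA => a b c; rewrite !idlE -lactA.
  + by move=> p q r x y z; apply: hk_mulA => a b c; rewrite !idrE idlE -ractA.
  + by move=> p q r x y z; apply: hk_mulA => a b c; rewrite !idrE !idlE lractA.
  + by move=> p x; apply: hk_mul_1l => a; rewrite idlE lact1.
  + by move=> p x; apply: hk_mul_1r => a; rewrite idrE ract1.
Qed.
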